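(* Let $M$ be a smooth manifold modelled on a Hilbert space (or self-dual Banach space) $\mathbb{E}$ with atlas $\{(U_\alpha,\psi_\alpha)\}_{\alpha\in I}$, let $g$ be a Riemannian metric on $M$ with local representatives $g_\alpha$, let $\nabla$ be a linear connection on $M$, let $k\in\mathbb{N}$, $k\ge 1$, and let $\Phi_\alpha^k:\pi_k^{-1}(U_\alpha)\to\psi_\alpha(U_\alpha)\times\mathbb{E}^k$ be the vector bundle trivializations of $\pi_k:T^kM\to M$ induced by $\nabla$ (defined in the context). For $\alpha\in I$, $x\in U_\alpha$ and $[\gamma_1,x]_k,[\gamma_2,x]_k\in T^k_xM$ put $$G_\alpha^k\big([\gamma_1,x]_k,[\gamma_2,x]_k\big)=\sum_{i=1}^kg_\alpha(x)\Big(\mathrm{proj}_i\circ\Phi_\alpha^k([\gamma_1,x]_k),\ \mathrm{proj}_i\circ\Phi_\alpha^k([\gamma_2,x]_k)\Big),$$ where $\mathrm{proj}_i$ denotes the projection of $\psi_\alpha(U_\alpha)\times\mathbb{E}^k$ onto its $(i+1)$-th factor. Then the family $\{G_\alpha^k\}_{\alpha\in I}$ defines a Riemannian metric on (the vector bundle) $T^kM$ over $M$.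
   Context: For $x_0\in M$ let $C_{x_0}$ be the set of smooth curves $\gamma:(-\epsilon,\epsilon)\to M$ with $\gamma(0)=x_0$; $\gamma_1\approx^k_{x_0}\gamma_2$ iff $\gamma_1^{(j)}(0)=\gamma_2^{(j)}(0)$ for $1\le j\le k$ (in a chart). $T^kM=\bigcup_{x\in M}T^k_xM$ with $T^k_xM=C_x/\approx^k_x$, the class of $\gamma$ is $[\gamma,x]_k$, and $\pi_k:T^kM\to M$, $[\gamma,x]_k\mapsto x$. $T^kM$ carries the smooth structure with charts $[\gamma,x]_k\mapsto\big((\psi_\alpha\circ\gamma)(0),(\psi_\alpha\circ\gamma)'(0),\dots,\frac1{k!}(\psi_\alpha\circ\gamma)^{(k)}(0)\big)$. A linear connection $\nabla$ on $M$ is given by local components $\Gamma_\alpha$: smooth maps $\psi_\alpha(U_\alpha)\to L^2(\mathbb{E},\mathbb{E};\mathbb{E})$, written $(x;\xi,y)\mapsto\Gamma_\alpha(x,\xi)y$, such that on overlaps, with $\psi_{\beta\alpha}=\psi_\beta\circ\psi_\alpha^{-1}$, $d\psi_{\beta\alpha}(x)[\Gamma_\alpha(x,\xi)y]=d^2\psi_{\beta\alpha}(x)(\xi,y)+\Gamma_\beta(\psi_{\beta\alpha}(x),d\psi_{\beta\alpha}(x)\xi)\,d\psi_{\beta\alpha}(x)y$. Define $\stackrel{1}{M}_\alpha(x,\xi_1)y=\Gamma_\alpha(x,\xi_1)y$ and, for $i\ge2$, $$\stackrel{i}{M}_\alpha(x,\xi_1,\dots,\xi_i)y=\frac1i\Big(\sum_{l=1}^{i}\partial_l\stackrel{i-1}{M}_\alpha(x,\xi_1,\dots,\xi_{i-1})(y,l\xi_l)+\stackrel{1}{M}_\alpha(x,\xi_1)\big[\stackrel{i-1}{M}_\alpha(x,\xi_1,\dots,\xi_{i-1})y\big]\Big),$$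 where $\partial_l(\cdot)(y,v)$ is the derivative, in direction $v$ in the $l$-th of the variables $(x,\xi_1,\dots,\xi_{i-1})$, of $(x,\xi_1,\dots,\xi_{i-1})\mapsto\stackrel{i-1}{M}_\alpha(x,\xi_1,\dots,\xi_{i-1})y$. With $\gamma_\alpha=\psi_\alpha\circ\gamma$, the trivializations are $\Phi_\alpha^k([\gamma,x]_k)=(\gamma_\alpha(0),\gamma_\alpha'(0),z_\alpha^2,\dots,z_\alpha^k)$ with, for $2\le i\le k$, $$z_\alpha^i=\frac1i\Big\{\frac{1}{(i-1)!}\gamma_\alpha^{(i)}(0)+\sum_{j=1}^{i-1}\frac{1}{(i-j-1)!}\stackrel{j}{M}_\alpha\big[\gamma_\alpha(0),\gamma_\alpha'(0),\dots,\tfrac1{j!}\gamma_\alpha^{(j)}(0)\big]\gamma_\alpha^{(i-j)}(0)\Big\}.$$ They make $\pi_k:T^kM\to M$ a smooth vector bundle. $g_\alpha(x)$ denotes the inner product on $\mathbb{E}$ representing $g_x$ in the chart $\psi_\alpha$. A Riemannian metric on a vector bundle is a smooth assignment to each fibre of a continuous symmetric positive definite bilinear form inducing an isomorphism of the fibre with its dual. *)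

(* Defs.v *)
From HB Require Import structures.
From mathcomp Require Import all_boot all_order all_algebra.
From mathcomp Require Import all_classical all_reals all_analysis.

Set Implicit Arguments.
Unset Strict Implicit.
Unset Printing Implicit Defensive.

Import Order.TTheory GRing.Theory Num.Theory.
Import numFieldNormedType.Exports.

Local Open Scope classical_set_scope.
Local Open Scope ring_scope.

(** * The normed space L(E, F) of continuous linear maps *)

Definition clin_pred (R : realType) (E F : normedModType R) : {pred (E -> F)} :=
  fun f => `[< linear f /\ continuous f >].

Record clin (R : realType) (E F : normedModType R) := Clin {
  clin_fun :> E -> F ;
  clinP : clin_fun \in @clin_pred R E F }.

Section CLinTheory.
Variables (R : realType) (E F : normedModType R).

HB.instance Definition _ := [isSub for @clin_fun R E F].
HB.instance Definition _ := [Choice of clin E F by <:].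

Lemma clin_linear (f : clin E F) : linear f.
Proof. by have /asboolP[] := clinP f. Qed.

Lemma clin_continuous (f : clin E F) : continuous f.
Proof. by have /asboolP[] := clinP f. Qed.

HB.instance Definition _ (f : clin E F) :=
  GRing.isLinear.Build R E F _ (clin_fun f) (clin_linear f).

Fact clin_submod_closed : submod_closed (@clin_pred R E F).
Proof.
split.
  by apply/asboolP; split=> [a u v|x]; [rewrite scaler0 addr0|exact: cvg_cst].
move=> a f g /asboolP[lf cf] /asboolP[lg cg]; apply/asboolP; split.
  move=> b u v; rewrite !fctE lf lg !scalerDr !scalerA (mulrC a) -!addrA.
  by congr (_ + _); rewrite addrCA.
by move=> x; apply: cvgD; [apply: cvgZr; exact: cf|exact: cg].
Qed.

HB.instance Definition _ :=
  GRing.isSubmodClosed.Build R (E -> F) (@clin_pred R E F) clin_submod_closed.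
HB.instance Definition _ := [SubChoice_isSubLmodule of clin E F by <:].

Definition opnorm (f : clin E F) : R :=
  sup [set `|f x| | x in [set x : E | `|x| <= 1]].

Lemma opnorm_has_sup (f : clin E F) :
  has_sup [set `|f x| | x in [set x : E | `|x| <= 1]].
Proof.
split; first by exists `|f 0|, 0 => //=; rewrite normr0 ler01.
have := @continuous_linear_bounded _ _ _ 0 f (@clin_continuous f 0).
move=> /bounded_funP/(_ 1)[M fM].
by exists M => _ [x /= x1 <-]; exact: fM.
Qed.

Lemma opnorm_ge (f : clin E F) x : `|x| <= 1 -> `|f x| <= opnorm f.
Proof.
move=> x1; apply: ub_le_sup; last by exists x.
by case: (opnorm_has_sup f).
Qed.

Lemma opnorm_le (f : clin E F) M :
  (forall x, `|x| <= 1 -> `|f x| <= M) -> opnorm f <= M.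
Proof.
move=> fM; apply: ge_sup; first by case: (opnorm_has_sup f).
by move=> _ [x /= x1 <-]; exact: fM.
Qed.

Fact opnormD (f g : clin E F) : opnorm (f + g) <= opnorm f + opnorm g.
Proof.
apply: opnorm_le => x x1.
by rewrite (le_trans (ler_normD _ _))// lerD// opnorm_ge.
Qed.

Fact opnormZ (a : R) (f : clin E F) : opnorm (a *: f) = `|a| * opnorm f.
Proof.
have le1 b (h : clin E F) : opnorm (b *: h) <= `|b| * opnorm h.
  apply: opnorm_le => x x1.
  by rewrite [leLHS]normrZ ler_wpM2l// opnorm_ge.
apply/eqP; rewrite eq_le le1 /=.
have [->|a0] := eqVneq a 0.
  rewrite normr0 mul0r scale0r.
  by apply: le_trans (@opnorm_ge 0 0 _); rewrite ?normr0// ler01.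
rewrite -ler_pdivlMl ?normr_gt0// -normfV.
by apply: le_trans (le1 _ _); rewrite scalerA mulVf// scale1r.
Qed.

Fact opnorm_eq0 (f : clin E F) : opnorm f = 0 -> f = 0.
Proof.
move=> f0; apply/val_inj/funext => x /=.
have [->|x0] := eqVneq x 0; first by rewrite linear0.
have xn : `|x| != 0 by rewrite normr_eq0.
have := @opnorm_ge f (`|x|^-1 *: x); rewrite f0 normfZV// lexx => /(_ isT).
rewrite normr_le0 linearZ/= scaler_eq0 invr_eq0 (negbTE xn) /=.
by move=> /eqP.
Qed.

HB.instance Definition _ :=
  Lmodule_isNormed.Build R (clin E F) opnormD opnormZ opnorm_eq0.

End CLinTheory.

(** * The normed space E^k, with the supremum norm *)

Section FfunNorm.
Variables (R : realType) (I : finType) (E : normedModType R).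

Definition ffnorm (v : {ffun I -> E}) : R := \big[Num.max/0]_i `|v i|.

Fact ffnormD v w : ffnorm (v + w) <= ffnorm v + ffnorm w.
Proof.
apply: bigmax_le => [|i _]; first by rewrite addr_ge0// bigmax_ge_id.
rewrite ffunE (le_trans (ler_normD _ _))// lerD//.
  exact: (le_bigmax _ (fun i => `|v i|)).
exact: (le_bigmax _ (fun i => `|w i|)).
Qed.

Fact ffnormZ (a : R) v : ffnorm (a *: v) = `|a| * ffnorm v.
Proof.
rewrite /ffnorm; under eq_bigr do rewrite ffunE normrZ.
elim/big_rec2: _ => [|i x y _ ->]; first by rewrite mulr0.
by rewrite maxr_pMr.
Qed.

Fact ffnorm_eq0 v : ffnorm v = 0 -> v = 0.
Proof.
move=> v0; apply/ffunP => i; rewrite ffunE; apply/eqP.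
rewrite -normr_le0 -v0.
exact: (le_bigmax _ (fun i => `|v i|)).
Qed.

HB.instance Definition _ :=
  Lmodule_isNormed.Build R {ffun I -> E} ffnormD ffnormZ ffnorm_eq0.

End FfunNorm.

(** * Smooth maps between normed spaces *)

Fact clin0_subproof (R : realType) (E F : normedModType R) :
  (fun _ : E => 0 : F) \in @clin_pred R E F.
Proof.
by apply/asboolP; split=> [a u v|x]; [rewrite scaler0 addr0|exact: cvg_cst].
Qed.

(* The Fréchet derivative ['d f x] as a point of the normed space L(E, F); it
   takes the junk value 0 where ['d f x] is not continuous, hence only at points
   where [f] is not differentiable. *)
Definition fderiv (R : realType) (E F : normedModType R) (f : E -> F) (x : E) :
    clin E F :=
  if pselect (('d f x : E -> F) \in @clin_pred R E F) is left df
  then Clin df else Clin (clin0_subproof E F).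

Fixpoint Cn_on (n : nat) (R : realType) (E F : normedModType R) (U : set E)
    (f : E -> F) : Prop :=
  match n with
  | 0 => forall x, U x -> {for x, continuous f}
  | m.+1 => (forall x, U x -> differentiable f x) /\ Cn_on m U (fderiv f)
  end.

Definition smooth_on (R : realType) (E F : normedModType R) (U : set E)
    (f : E -> F) : Prop :=
  forall n, Cn_on n U f.

(** * Hilbert spaces, self-dual spaces, inner products *)

Definition toplin_iso (R : realType) (E F : normedModType R) (T : clin E F) :=
  exists S : clin F E, cancel T S /\ cancel S T.

Definition self_dual (R : realType) (E : normedModType R) :=
  exists T : clin E (clin E R^o), toplin_iso T.

Definition hilbert_norm (R : realType) (E : normedModType R) :=
  exists ip : E -> E -> R,
    [/\ forall a u v w, ip (a *: u + v) w = a * ip u w + ip v w,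
        forall u v, ip u v = ip v u &
        forall u, `|u| ^+ 2 = ip u u].

Definition metric_form (R : realType) (F : normedModType R)
    (b : clin F (clin F R^o)) :=
  [/\ forall u v, b u v = b v u,
      forall u, u != 0 -> 0 < (b u u : R) &
      toplin_iso b].

(** * Manifolds modelled on E *)

(* [chart a] and [chartV a] are total functions; only their values on [dom a]
   and on [chart a @` dom a] are meaningful. *)
Record atlas (R : realType) (E : normedModType R) (M : topologicalType) :=
  Atlas {
  idx : Type ;
  dom : idx -> set M ;
  chart : idx -> M -> E ;
  chartV : idx -> E -> M ;
  dom_open : forall a, open (dom a) ;
  dom_cover : forall x, exists a, dom a x ;
  chart_open : forall a, open (chart a @` dom a) ;
  chartK : forall a x, dom a x -> chartV a (chart a x) = x ;
  chart_continuous : forall a x, dom a x -> {for x, continuous (chart a)} ;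
  chartV_continuous : forall a x, dom a x ->
    {for chart a x, continuous (chartV a)} ;
  transition_smooth : forall a b,
    smooth_on (chart a @` (dom a `&` dom b)) (chart b \o chartV a) }.

Definition transition (R : realType) (E : normedModType R) (M : topologicalType)
    (A : atlas E M) (a b : idx A) : E -> E :=
  chart b \o chartV a.

(** * Vector bundles and their Riemannian metrics *)

(* A family of sets over M with, for each chart, candidates for the fibre
   components of a trivialization: over [dom a], a point [u] of the fibre at [x]
   is sent to [(chart a x, triv a u)]. *)
Record bundle_data (R : realType) (E : normedModType R) (M : topologicalType)
    (A : atlas E M) (F : normedModType R) := BundleData {
  fibre : M -> Type ;
  triv : forall (a : idx A) (x : M), fibre x -> F }.

Arguments triv {R E M A F} b a {x} _.

(* The vector space structure and the topology of the fibre are those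
   transported by any of the [triv a]. *)
Definition is_vector_bundle (R : realType) (E : normedModType R)
    (M : topologicalType) (A : atlas E M) (F : normedModType R)
    (B : bundle_data A F) : Prop :=
  (forall (a : idx A) x, dom a x -> bijective (@triv _ _ _ _ _ B a x)) /\
  (forall a b : idx A, exists tau : E -> clin F F,
    smooth_on (chart a @` (dom a `&` dom b)) tau /\
    forall x, dom a x -> dom b x -> forall u : fibre B x,
      triv B b u = tau (chart a x) (triv B a u)).

Definition local_rep (R : realType) (E : normedModType R)
    (M : topologicalType) (A : atlas E M) (F : normedModType R)
    (B : bundle_data A F) (G : forall x, fibre B x -> fibre B x -> R)
    (a : idx A) (b : E -> clin F (clin F R^o)) : Prop :=
  forall x, dom a x -> forall u v : fibre B x,
    G x u v = b (chart a x) (triv B a u) (triv B a v).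

Definition riemannian_metric (R : realType) (E : normedModType R)
    (M : topologicalType) (A : atlas E M) (F : normedModType R)
    (B : bundle_data A F) (G : forall x, fibre B x -> fibre B x -> R) : Prop :=
  is_vector_bundle B /\
  forall a : idx A, exists b : E -> clin F (clin F R^o),
    [/\ local_rep G a b,
        smooth_on (chart a @` dom a) b &
        forall x, dom a x -> metric_form (b (chart a x))].

(** * Higher order tangent bundles *)

(* Only the restriction of [cfun] to the interval (-rad, rad) is meaningful. *)
Record curve (R : realType) (E : normedModType R) (M : topologicalType)
    (A : atlas E M) (x0 : M) := Curve {
  cfun :> R -> M ;
  rad : R ;
  rad_gt0 : 0 < rad ;
  cfun0 : cfun 0 = x0 ;
  cfun_continuous : forall t, `|t| < rad -> {for t, continuous cfun} ;
  cfun_smooth : forall a : idx A, @smooth_on R R^o E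
    [set t | `|t| < rad /\ dom a (cfun t)] (chart a \o cfun) }.

Definition jet_eq (R : realType) (E : normedModType R) (M : topologicalType)
    (A : atlas E M) (k : nat) (x : M) (c1 c2 : curve A x) : Prop :=
  exists2 a : idx A, dom a x & forall j, (1 <= j <= k)%N ->
    derive1n j (chart a \o c1) 0 = derive1n j (chart a \o c2) 0.

(* The set of equivalence classes of [jet_eq k]. *)
Definition jet (R : realType) (E : normedModType R) (M : topologicalType)
    (A : atlas E M) (k : nat) (x : M) : Type :=
  {T : set (curve A x) | exists c, T = [set c' | jet_eq k c c']}.

Definition jet_repr (R : realType) (E : normedModType R) (M : topologicalType)
    (A : atlas E M) (k : nat) (x : M) (T : jet A k x) : curve A x :=
  projT1 (cid (proj2_sig T)).

Definition tangent_bundle (R : realType) (E : normedModType R)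
    (M : topologicalType) (A : atlas E M) : bundle_data A E :=
  @BundleData R E M A E (jet A 1)
    (fun a x T => derive1 (chart a \o jet_repr T) 0).

(** * Linear connections and the trivializations they induce *)

(* L^2(E, E; E) is the space L(E, L(E, E)). *)
Record linear_connection (R : realType) (E : normedModType R)
    (M : topologicalType) (A : atlas E M) := LinearConnection {
  christoffel :> idx A -> E -> clin E (clin E E) ;
  christoffel_smooth : forall a,
    smooth_on (chart a @` dom a) (christoffel a) ;
  christoffel_transition : forall a b x, (chart a @` (dom a `&` dom b)) x ->
    forall xi y,
    fderiv (transition a b) x (christoffel a x xi y) =
      fderiv (fderiv (transition a b)) x xi y +
      christoffel b (transition a b x)
        (fderiv (transition a b) x xi) (fderiv (transition a b) x y) }.

(* [Mop Gam i u y] is the i-th operator M applied to y, at the point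
   (x, xi_1, ..., xi_i) = (u 0, u 1, ..., u i). Its l-th variable, 1 <= l, is
   thus [u l.-1]. The value at i = 0 is not used. *)
Fixpoint Mop (R : realType) (E : normedModType R) (Gam : E -> clin E (clin E E))
    (i : nat) (u : nat -> E) (y : E) {struct i} : E :=
  match i with
  | 0 => y
  | 1 => Gam (u 0) (u 1) y
  | S ((S _) as j) =>
      i%:R^-1 *:
        (\sum_(1 <= l < i.+1)
            'D_(l%:R *: u l)
               (fun v : E => Mop Gam j [eta u with l.-1 |-> v] y) (u l.-1)
         + Gam (u 0) (u 1) (Mop Gam j u y))
  end%N.

Definition taylor (R : realType) (E : normedModType R) (c : R -> E) (j : nat) :
    E := (j`!)%:R^-1 *: derive1n j c 0.

(* For i = 1 the sum is empty and this is c'(0). *)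
Definition zcoord (R : realType) (E : normedModType R)
    (Gam : E -> clin E (clin E E)) (c : R -> E) (i : nat) : E :=
  i%:R^-1 *:
    ((i.-1`!)%:R^-1 *: derive1n i c 0 +
     \sum_(1 <= j < i)
        ((i - j - 1)`!)%:R^-1 *: Mop Gam j (taylor c) (derive1n (i - j) c 0)).

Definition higher_tangent_bundle (R : realType) (E : normedModType R)
    (M : topologicalType) (A : atlas E M) (nabla : linear_connection A)
    (k : nat) : bundle_data A {ffun 'I_k -> E} :=
  @BundleData R E M A {ffun 'I_k -> E} (jet A k)
    (fun a x T => [ffun i : 'I_k =>
       zcoord (nabla a) (chart a \o jet_repr T) i.+1]).

Definition lifted_metric (R : realType) (E : normedModType R)
    (M : topologicalType) (A : atlas E M)
    (gloc : idx A -> E -> clin E (clin E R^o)) (nabla : linear_connection A)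
    (k : nat) (a : idx A) (x : M) (T1 T2 : jet A k x) : R :=
  \sum_(i < k)
     (gloc a (chart a x) (triv (higher_tangent_bundle nabla k) a T1 i)
                         (triv (higher_tangent_bundle nabla k) a T2 i) : R).

(* Main.v *)
Require Import Defs.
From HB Require Import structures.
From mathcomp Require Import all_boot all_order all_algebra.
From mathcomp Require Import all_classical all_reals all_analysis.
From mathcomp Require Import ring.

Set Implicit Arguments.
Unset Strict Implicit.
Unset Printing Implicit Defensive.

Import Order.TTheory GRing.Theory Num.Theory.
Import numFieldNormedType.Exports.

Local Open Scope classical_set_scope.
Local Open Scope ring_scope.

(** Along a curve c read in a chart, write D V = V' + Gam(c, c') V for the covariant
derivative of a vector field V. The operators M_j are built so that, evaluated
at xi_l = c^(l) / l!, they satisfy (j+1) M_(j+1) = M_j' + Gam(c, c') M_j, the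
prime being the derivative in time: the total derivative of M_j along the curve
is the sum of its partial derivatives, the l-th of which is taken in the
direction l xi_l, the velocity of the l-th variable. Hence, by induction on n
and Pascal's rule,

  D^n c' = sum_(j <= n) binomial(n, j) j! M_j c^(n - j + 1)

([acceleration_Mop]), and the fibre coordinate z^i is D^(i-1) c' (0) / i!
([zcoord_acceleration]).

The transformation law of the Christoffel maps makes D commute with the
differential of a change of charts psi. So every z^i transforms by d psi,
the same linear map in each of the k slots ([acceleration_transition],
[zcoord_chart]).

Two consequences carry the rest. First, z^i is c^(i)(0) / i! plus terms in lower
derivatives, so (z^1, ..., z^k) and (c'(0), ..., c^(k)(0)) determine each other;
combined with the linear transformation of the z^i, this shows that equality of
k-jets does not depend on the chart, that the trivializations are injective on
fibres, and, with polynomial curves, that they are surjective ([triv_bij]). The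
transition maps of the bundle are diag(d psi, ..., d psi), which depend smoothly
on the base point. Secondly, tangent vectors also transform by d psi and fill E,
so the local representatives of g satisfy
g_b(d psi u, d psi v) = g_a(u, v) for all u, v in E ([gloc_transition]), and the
sum over the k slots is independent of the chart. It is block diagonal
with k copies of g_a, so it inherits symmetry, positivity, invertibility and
smoothness from g_a ([metric_form_block], [smooth_on_blockform]).

The analytic input is a calculus of smooth maps between normed spaces in which
all the products that occur are applications of a continuous bilinear map: the
derivative of such a product is a sum of two products of the same kind, so one
induction on the order of differentiability handles all of them
([Cn_on_bilin]). *)

(** * Continuous linear maps: bounds, composition, exchange of arguments *)

Section ClinConstructions.
Variable R : realType.
Implicit Types E F G H : normedModType R.

Lemma clin_eqP E F (f g : clin E F) : f =1 g -> f = g.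
Proof. by move=> fg; apply/val_inj/funext. Qed.

Lemma clin_addE E F (f g : clin E F) x : (f + g) x = f x + g x.
Proof. by []. Qed.

Lemma clin_scaleE E F a (f : clin E F) x : (a *: f) x = a *: f x.
Proof. by []. Qed.

Lemma clin_sumE E F I (r : seq I) (P : pred I) (f : I -> clin E F) x :
  (\sum_(i <- r | P i) f i) x = \sum_(i <- r | P i) f i x.
Proof. by elim/big_rec2 : _ => // i y z _ <-. Qed.

Lemma clin_bound E F (f : clin E F) x : `|f x| <= `|f| * `|x|.
Proof.
have [->|x0] := eqVneq x 0; first by rewrite linear0 !normr0 mulr0.
have xp : 0 < `|x| by rewrite normr_gt0.
have := @opnorm_ge R E F f (`|x|^-1 *: x).
rewrite normfZV// lexx => /(_ isT).
rewrite linearZ/= normrZ normfV normr_id ler_pdivrMl//.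
by rewrite mulrC.
Qed.

Lemma clin_norm_le E F (f : clin E F) M : 0 <= M ->
  (forall x, `|f x| <= M * `|x|) -> `|f| <= M.
Proof.
move=> M0 fM; apply: opnorm_le => x x1; apply: (le_trans (fM x)).
by rewrite -[leRHS]mulr1 ler_wpM2l.
Qed.

Fact mk_clin_subproof E F (f : E -> F) (fl : linear f) M
  (fM : forall x, `|f x| <= M * `|x|) : f \in @clin_pred R E F.
Proof.
apply/asboolP; split => //.
pose fL : {linear E -> F} := HB.pack f (GRing.isLinear.Build _ _ _ _ f fl).
apply: (@bounded_linear_continuous _ _ _ fL); apply/bounded_funP => r.
exists (`|M| * `|r|) => x xr; apply: (le_trans (fM x)).
apply: (le_trans (ler_norm _)); rewrite normrM normr_id ler_wpM2l//.
exact: (le_trans xr (ler_norm _)).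
Qed.

(** The elementary continuous linear maps below all come with an explicit bound, from
which continuity follows. *)
Definition mk_clin E F (f : E -> F) (fl : linear f) M
  (fM : forall x, `|f x| <= M * `|x|) : clin E F :=
  Clin (mk_clin_subproof fl fM).

Fact clin_comp_linear E F G (g : clin F G) (f : clin E F) : linear (g \o f).
Proof. by move=> a u v /=; rewrite !linearP. Qed.

Fact clin_comp_bound E F G (g : clin F G) (f : clin E F) x :
  `|(g \o f) x| <= (`|g| * `|f|) * `|x|.
Proof.
apply: (le_trans (clin_bound _ _)).
by rewrite -mulrA ler_wpM2l// clin_bound.
Qed.

Definition clin_comp E F G (g : clin F G) (f : clin E F) : clin E G :=
  mk_clin (clin_comp_linear g f) (clin_comp_bound g f).

Lemma clin_comp_norm E F G (g : clin F G) (f : clin E F) :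
  `|clin_comp g f| <= `|g| * `|f|.
Proof. by apply: clin_norm_le => // x; exact: clin_comp_bound. Qed.

Fact clin_postcomp_linear E F G (g : clin F G) : linear (@clin_comp E F G g).
Proof. by move=> a u v; apply: clin_eqP => x /=; rewrite linearP. Qed.

Definition clin_postcomp E F G (g : clin F G) : clin (clin E F) (clin E G) :=
  mk_clin (@clin_postcomp_linear E F G g) (@clin_comp_norm E F G g).

Fact clin_compose_linear E F G : linear (@clin_postcomp E F G).
Proof. by move=> a u v; apply: clin_eqP => x; apply: clin_eqP => y. Qed.

Fact clin_compose_bound E F G (g : clin F G) :
  `|@clin_postcomp E F G g| <= 1 * `|g|.
Proof.
by rewrite mul1r; apply: clin_norm_le => // x; exact: clin_comp_norm.
Qed.

(** Composition as a continuous bilinear map, in curried form. *)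
Definition clin_compose E F G : clin (clin F G) (clin (clin E F) (clin E G)) :=
  mk_clin (@clin_compose_linear E F G) (@clin_compose_bound E F G).

Section Flip.
Variables E F G : normedModType R.

Fact flip_eval_linear (B : clin E (clin F G)) (y : F) : linear (fun x => B x y).
Proof. by move=> a u v; rewrite linearP. Qed.

Fact flip_eval_bound (B : clin E (clin F G)) (y : F) x :
  `|B x y| <= (`|B| * `|y|) * `|x|.
Proof.
apply: (le_trans (clin_bound _ _)).
by rewrite mulrAC ler_wpM2r// clin_bound.
Qed.

Definition flip_eval (B : clin E (clin F G)) (y : F) : clin E G :=
  mk_clin (flip_eval_linear B y) (flip_eval_bound B y).

Fact clin_flip_linear (B : clin E (clin F G)) : linear (flip_eval B).
Proof. by move=> a u v; apply: clin_eqP => x /=; rewrite linearP. Qed.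

Fact clin_flip_bound (B : clin E (clin F G)) y :
  `|flip_eval B y| <= `|B| * `|y|.
Proof.
by apply: clin_norm_le => [|x]; [rewrite mulr_ge0|exact: flip_eval_bound].
Qed.

Definition clin_flip (B : clin E (clin F G)) : clin F (clin E G) :=
  mk_clin (clin_flip_linear B) (clin_flip_bound B).

Fact clin_flipL_linear : linear clin_flip.
Proof. by move=> a u v; apply: clin_eqP => x; apply: clin_eqP => y. Qed.

Fact clin_flipL_bound B : `|clin_flip B| <= 1 * `|B|.
Proof.
by rewrite mul1r; apply: clin_norm_le => // y; exact: clin_flip_bound.
Qed.

(** Exchanging the two arguments is itself continuous and linear. Together with
[clin_compose] it yields the two halves of the Leibniz rule as elements of spaces
of continuous linear maps. *)
Definition clin_flipL : clin (clin E (clin F G)) (clin F (clin E G)) :=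
  mk_clin clin_flipL_linear clin_flipL_bound.

End Flip.

Fact clin_id_subproof E x : `|@idfun E x| <= 1 * `|x|.
Proof. by rewrite mul1r. Qed.

Definition clin_id E : clin E E :=
  @mk_clin E E idfun (fun _ _ _ => erefl) 1 (@clin_id_subproof E).

Lemma clin_compE E F G (g : clin F G) (f : clin E F) x :
  clin_comp g f x = g (f x).
Proof. by []. Qed.

(** Precomposition with a fixed map. *)
Definition clin_pre E F G (f : clin E F) : clin (clin F G) (clin E G) :=
  clin_flip (clin_compose E F G) f.

End ClinConstructions.

(** * The Fréchet derivative: criterion, chain rule, Leibniz rule *)

Section FrechetCalculus.
Variable R : realType.
Implicit Types E F G H : normedModType R.

Lemma fderiv_is_diff E F (f : E -> F) x (L : clin E F) :
  is_diff x f L -> fderiv f x = L.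
Proof.
move=> df; have dfL : 'd f x = L :> (E -> F) by exact: diff_val.
rewrite /fderiv; case: pselect => /=[p|np].
  by apply: clin_eqP => y /=; rewrite dfL.
by exfalso; apply: np; rewrite dfL; exact: clinP.
Qed.

Lemma is_diff_fderiv E F (f : E -> F) x :
  differentiable f x -> is_diff x f (fderiv f x).
Proof.
move=> df; apply: DiffDef => //; rewrite /fderiv; case: pselect => //= np.
exfalso; apply: np; apply/asboolP; split; first by move=> a u v; rewrite linearP.
exact: diff_continuous.
Qed.

(** The epsilon form of differentiability. Unlike the Landau form, it only involves
the values of f near x, which makes locality immediate. *)
Lemma is_diffP E F (f : E -> F) x (L : clin E F) :
  is_diff x f L <-> forall e, 0 < e ->
    \forall y \near x, `|f y - f x - L (y - x)| <= e * `|y - x|.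
Proof.
split=> [dfL e e0|fxL].
  have df : differentiable f x by exact: ex_diff.
  have dL : 'd f x = L :> (E -> F) by exact: diff_val.
  move/diff_locallyP : df; rewrite dL => -[_ /eqaddoP/(_ _ e0)].
  rewrite near_simpl (near_shift x) sub0r /=; apply: filterS => y /=.
  by rewrite !fctE/= subrK opprD addrA.
have Lx : f \o shift x = cst (f x) + L +o_ 0 id.
  apply/eqaddoP => e /fxL.
  rewrite near_simpl (near_shift 0 x) subr0 /=; apply: filterS => y /=.
  by rewrite !fctE/= addrK opprD addrA.
have dL : 'd f x = L :> (E -> F).
  by apply: diff_unique => //; exact: clin_continuous.
apply: DiffDef => //; apply/diff_locallyP; rewrite dL; split => //.
exact: clin_continuous.
Qed.

Lemma near_eq_is_diff E F (f g : E -> F) x (L : clin E F) :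
  {near x, f =1 g} -> is_diff x f L -> is_diff x g L.
Proof.
move=> fg /is_diffP fL; apply/is_diffP => e /fL.
have fgx : f x = g x by exact: nbhs_singleton fg.
by apply: filterS2 fg => y <-; rewrite fgx.
Qed.

Lemma is_diff_clin E F (L : clin E F) x : is_diff x L L.
Proof.
apply: DiffDef; first by apply: linear_differentiable; exact: clin_continuous.
by rewrite diff_lin//; exact: clin_continuous.
Qed.

Lemma is_diff_clin_comp E F G (f : E -> F) (g : F -> G) x
    (L : clin E F) (K : clin F G) :
  is_diff x f L -> is_diff (f x) g K -> is_diff x (g \o f) (clin_comp K L).
Proof. by move=> df dg; exact: is_diff_comp. Qed.

Section Leibniz.
Variables (E E1 E2 G : normedModType R) (B : clin E1 (clin E2 G)).

Let B2 (x : E1) (y : E2) : G := B x y.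

(** The uncurried form of B, on which the derivative of a bilinear map on a product
space is available. *)
Fact clin_is_bilinear :
  bilinear_for (GRing.Scale.Law.clone _ _ *:%R _)
    (GRing.Scale.Law.clone _ _ *:%R _) B2.
Proof.
by split=> [u'|u] a x y /=; rewrite /B2 linearP.
Qed.

Let bilinB : {bilinear E1 -> E2 -> G} :=
  HB.pack B2 (bilinear_isBilinear.Build R E1 E2 G _ _ B2 clin_is_bilinear).

(** From B(a, b) - B(a', b') = B(a - a', b') + B(a, b - b'), bounding |b'| by |b| + 1. *)
Lemma clin_bilin_continuous : continuous (fun p : E1 * E2 => B p.1 p.2).
Proof.
move=> [a b]; apply/cvgrPdist_le => e e0 /=.
have Bfst : B p.1 @[p --> (a, b)] --> B a.
  by apply: (cvg_comp _ _ cvg_fst); exact: clin_continuous.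
have snd : p.2 @[p --> (a, b)] --> b by exact: cvg_snd.
pose m : R := `|b| + 1.
have m0 : 0 < m by rewrite ltr_wpDl.
have n0 : 0 < `|B a| + 1 by rewrite ltr_wpDl.
near=> p.
have -> : B a b - B p.1 p.2 = B (a - p.1) p.2 + B a (b - p.2).
  rewrite !linearB/= -[X in _ = X + _]/(B a p.2 - B p.1 p.2).
  by rewrite [RHS]addrC addrA subrK.
apply: (le_trans (ler_normD _ _)); rewrite (splitr e) lerD//.
- apply: (le_trans (clin_bound _ _)).
  apply: (@le_trans _ _ (e / 2 / m * m)); last by rewrite divfK// gt_eqF.
  apply: ler_pM => //.
    rewrite linearB/=; near: p.
    move/cvgrPdist_le : Bfst; apply.
    by rewrite !divr_gt0.
  rewrite /m.
  have : `|b - p.2| <= 1.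
    near: p.
    by move/cvgrPdist_le : snd; apply.
  move=> bp; rewrite -[X in `|X|](subKr b).
  by rewrite (le_trans (ler_normB _ _))// lerD2l.
- apply: (le_trans (clin_bound _ _)).
  apply: (@le_trans _ _ ((`|B a| + 1) * (e / 2 / (`|B a| + 1)))); last first.
    by rewrite mulrC divfK// gt_eqF.
  apply: ler_pM => //; first by rewrite lerDl.
  near: p.
  by move/cvgrPdist_le : snd; apply; rewrite !divr_gt0.
Unshelve. all: by end_near. Qed.

(** Variation of the first argument: A, y give h |-> B (A h) y. *)
Definition leibniz1 : clin (clin E E1) (clin E2 (clin E G)) :=
  clin_comp (clin_flipL E E2 G) (clin_compose E E1 (clin E2 G) B).

(** Variation of the second argument: x, A give h |-> B x (A h). *)
Definition leibniz2 : clin E1 (clin (clin E E2) (clin E G)) :=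
  clin_comp (clin_compose E E2 G) B.

(** The derivative is again a sum of two bilinear expressions, in f, g and their
derivatives; this is what makes the induction of [Cn_on_bilin] close up. *)
Lemma is_diff_bilin (f : E -> E1) (g : E -> E2) x
    (Lf : clin E E1) (Lg : clin E E2) :
  is_diff x f Lf -> is_diff x g Lg ->
  is_diff x (fun y => B (f y) (g y))
    (leibniz1 Lf (g x) + leibniz2 (f x) Lg : clin E G).
Proof.
move=> df dg.
have dB : is_diff (f x, g x) (fun p : E1 * E2 => B p.1 p.2)
    (fun q => B (f x) q.2 + B q.1 (g x)).
  apply: DiffDef.
    exact: (@differentiable_bilin _ _ _ _ bilinB _ clin_bilin_continuous).
  exact: (@diff_bilin _ _ _ _ bilinB _ clin_bilin_continuous).
have dfg : is_diff x (fun y => B (f y) (g y)) _ :=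
  is_diff_comp (is_diff_pair df dg) dB.
apply: (is_diff_eq dfg).
by apply/funext => h /=; rewrite addrC.
Qed.

End Leibniz.

End FrechetCalculus.

(** * Smooth maps are closed under the usual operations *)

Section SmoothCalculus.
Variable R : realType.
Implicit Types E F G H : normedModType R.

(** Openness of U is what allows derivatives of maps that agree only on U to be
identified. *)
Lemma eq_Cn_on n E F (U : set E) (f g : E -> F) :
  open U -> {in U, f =1 g} -> Cn_on n U f -> Cn_on n U g.
Proof.
move=> oU; elim: n F f g => [|n IH] F f g fg /=.
  move=> fc x Ux; have Unx : nbhs x U by exact: open_nbhs_nbhs.
  rewrite /prop_for/continuous_at -fg ?inE//.
  apply: cvg_trans (fc x Ux); apply: near_eq_cvg.
  by apply: filterS Unx => y Uy; rewrite fg// inE.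
move=> [df Cf].
have dg x : U x -> is_diff x g (fderiv f x).
  move=> Ux; apply: (@near_eq_is_diff _ _ _ f); last exact/is_diff_fderiv/df.
  have Unx : nbhs x U by exact: open_nbhs_nbhs.
  by apply: filterS Unx => y Uy; rewrite fg// inE.
split=> [x /dg []//|].
apply: IH Cf => x; rewrite inE => /dg /fderiv_is_diff.
by move=> ->.
Qed.

Lemma Cn_onS n E F (U : set E) (f : E -> F) : Cn_on n.+1 U f -> Cn_on n U f.
Proof.
elim: n F f => [|n IH] F f /=.
  by move=> [df _] x /df; exact: differentiable_continuous.
by move=> [df Cf]; split => //; exact: IH.
Qed.

Lemma Cn_on_subset n E F (U V : set E) (f : E -> F) :
  V `<=` U -> Cn_on n U f -> Cn_on n V f.
Proof.
move=> VU; elim: n F f => [|n IH] F f /=.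
  by move=> fc x /VU; exact: fc.
by move=> [df Cf]; split => [x /VU/df//|]; exact: IH.
Qed.

(** The introduction rule used below: it suffices to exhibit a derivative on U, since
the values of [fderiv f] outside U are irrelevant. *)
Lemma Cn_onSP n E F (U : set E) (f : E -> F) (f' : E -> clin E F) :
  open U -> (forall x, U x -> is_diff x f (f' x)) ->
  Cn_on n U f' -> Cn_on n.+1 U f.
Proof.
move=> oU df Cf'; split=> [x /df[]//|].
by apply: eq_Cn_on Cf' => // x; rewrite inE => /df/fderiv_is_diff ->.
Qed.

Lemma Cn_on_is_diff n E F (U : set E) (f : E -> F) x :
  Cn_on n.+1 U f -> U x -> is_diff x f (fderiv f x).
Proof. by move=> [df _] /df; exact: is_diff_fderiv. Qed.

Lemma Cn_on_cst n E F (U : set E) (a : F) : open U -> Cn_on n U (fun=> a).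
Proof.
move=> oU; elim: n F a => [|n IH] F a; first by move=> x _; exact: cst_continuous.
by apply: (@Cn_onSP _ _ _ _ _ (fun=> 0)).
Qed.

Lemma Cn_on_clin n E F (U : set E) (L : clin E F) : open U -> Cn_on n U L.
Proof.
move=> oU; case: n => [|n]; first by move=> x _; exact: clin_continuous.
apply: (@Cn_onSP _ _ _ _ _ (fun=> L)) => [//|x _|]; first exact: is_diff_clin.
exact: Cn_on_cst.
Qed.

Lemma Cn_onD n E F (U : set E) (f g : E -> F) : open U ->
  Cn_on n U f -> Cn_on n U g -> Cn_on n U (fun x => f x + g x).
Proof.
move=> oU; elim: n F f g => [|n IH] F f g.
  by move=> fc gc x Ux; apply: cvgD; [exact: fc|exact: gc].
move=> Cf Cg.
have dD x : U x -> is_diff x (fun x => f x + g x) (fderiv f x + fderiv g x).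
  move=> Ux.
  exact: (is_diffD (Cn_on_is_diff Cf Ux) (Cn_on_is_diff Cg Ux)).
by apply: (Cn_onSP oU dD); exact: (IH _ _ _ Cf.2 Cg.2).
Qed.

Lemma Cn_on_sum n E F (U : set E) I (r : seq I) (P : pred I) (f : I -> E -> F) :
  open U -> (forall i, P i -> Cn_on n U (f i)) ->
  Cn_on n U (fun x => \sum_(i <- r | P i) f i x).
Proof.
move=> oU Cf; elim: r => [|i r IH].
  by apply: (eq_Cn_on oU _ (Cn_on_cst n 0 oU)) => x _; rewrite big_nil.
have [Pi|nPi] := boolP (P i).
  apply: (eq_Cn_on oU _ (Cn_onD oU (Cf i Pi) IH)) => x _.
  by rewrite big_cons Pi.
by apply: (eq_Cn_on oU _ IH) => x _; rewrite big_cons (negbTE nPi).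
Qed.

(** The induction runs over all spaces at once, because the derivatives of f and g take
values in other spaces and are multiplied by other bilinear maps. *)
Lemma Cn_on_bilin n E E1 E2 G (B : clin E1 (clin E2 G)) (U : set E)
    (f : E -> E1) (g : E -> E2) : open U ->
  Cn_on n U f -> Cn_on n U g -> Cn_on n U (fun x => B (f x) (g x)).
Proof.
move=> oU; elim: n E1 E2 G B f g => [|n IH] E1 E2 G B f g.
  move=> fc gc x Ux.
  apply: (@continuous_comp _ _ _ (fun y => (f y, g y)) (fun p => B p.1 p.2)).
    exact: cvg_pair (fc _ Ux) (gc _ Ux).
  exact: clin_bilin_continuous.
move=> Cf Cg.
pose D x : clin E G :=
  leibniz1 E B (fderiv f x) (g x) + leibniz2 E B (f x) (fderiv g x).
have dD x : U x -> is_diff x (fun x => B (f x) (g x)) (D x).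
  move=> Ux.
  exact: (is_diff_bilin B (Cn_on_is_diff Cf Ux) (Cn_on_is_diff Cg Ux)).
apply: (Cn_onSP oU dD); rewrite /D; apply: (Cn_onD oU).
  exact: (IH _ _ _ (leibniz1 E B) _ _ Cf.2 (Cn_onS Cg)).
exact: (IH _ _ _ (leibniz2 E B) _ _ (Cn_onS Cf) Cg.2).
Qed.

(** The chain rule writes the derivative of g o f as a product of g' o f and f', which is
a bilinear expression to which the previous lemma and the induction hypothesis
apply. *)
Lemma Cn_on_comp n E F G (U : set E) (V : set F) (f : E -> F) (g : F -> G) :
  open U -> (forall x, U x -> V (f x)) ->
  Cn_on n U f -> Cn_on n V g -> Cn_on n U (g \o f).
Proof.
move=> oU UV; elim: n G g => [|n IH] G g.
  move=> fc gc x Ux; apply: continuous_comp; first exact: fc.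
  exact/gc/UV.
move=> Cf Cg.
pose D x := clin_compose E F G (fderiv g (f x)) (fderiv f x).
have dD x : U x -> is_diff x (g \o f) (D x).
  move=> Ux; apply: is_diff_clin_comp (Cn_on_is_diff Cf Ux) _.
  exact: (Cn_on_is_diff Cg (UV _ Ux)).
apply: (Cn_onSP oU dD); apply: (Cn_on_bilin _ oU); last exact: Cf.2.
exact: (IH _ _ (Cn_onS Cf) Cg.2).
Qed.

Lemma Cn_on_clin_comp n E F G (U : set E) (f : E -> F) (L : clin F G) :
  open U -> Cn_on n U f -> Cn_on n U (fun x => L (f x)).
Proof.
move=> oU Cf; apply: (@Cn_on_comp _ _ _ _ _ setT _ L) Cf _ => //.
by apply: Cn_on_clin; exact: openT.
Qed.

Lemma eq_smooth_on E F (U : set E) (f g : E -> F) :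
  open U -> {in U, f =1 g} -> smooth_on U f -> smooth_on U g.
Proof. by move=> oU fg sf n; exact: eq_Cn_on (sf n). Qed.

Lemma smooth_on_subset E F (U V : set E) (f : E -> F) :
  V `<=` U -> smooth_on U f -> smooth_on V f.
Proof. by move=> VU sf n; exact: Cn_on_subset (sf n). Qed.

Lemma smooth_on_is_diff E F (U : set E) (f : E -> F) x :
  smooth_on U f -> U x -> is_diff x f (fderiv f x).
Proof. by move=> /(_ 1%N); exact: Cn_on_is_diff. Qed.

Lemma smooth_on_fderiv E F (U : set E) (f : E -> F) :
  smooth_on U f -> smooth_on U (fderiv f).
Proof. by move=> sf n; have [] := sf n.+1. Qed.

Lemma smooth_on_cst E F (U : set E) (a : F) : open U -> smooth_on U (fun=> a).
Proof. by move=> oU n; exact: Cn_on_cst. Qed.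

Lemma smooth_on_clin E F (U : set E) (L : clin E F) : open U -> smooth_on U L.
Proof. by move=> oU n; exact: Cn_on_clin. Qed.

Lemma smooth_onD E F (U : set E) (f g : E -> F) : open U ->
  smooth_on U f -> smooth_on U g -> smooth_on U (fun x => f x + g x).
Proof. by move=> oU sf sg n; exact: Cn_onD. Qed.

Lemma smooth_on_sum E F (U : set E) I (r : seq I) (P : pred I)
    (f : I -> E -> F) :
  open U -> (forall i, P i -> smooth_on U (f i)) ->
  smooth_on U (fun x => \sum_(i <- r | P i) f i x).
Proof. by move=> oU sf n; apply: Cn_on_sum => // i /sf; exact. Qed.

Lemma smooth_on_bilin E E1 E2 G (B : clin E1 (clin E2 G)) (U : set E)
    (f : E -> E1) (g : E -> E2) : open U ->
  smooth_on U f -> smooth_on U g -> smooth_on U (fun x => B (f x) (g x)).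
Proof. by move=> oU sf sg n; exact: Cn_on_bilin. Qed.

Lemma smooth_on_comp E F G (U : set E) (V : set F) (f : E -> F) (g : F -> G) :
  open U -> (forall x, U x -> V (f x)) ->
  smooth_on U f -> smooth_on V g -> smooth_on U (g \o f).
Proof. by move=> oU UV sf sg n; exact: Cn_on_comp UV _ _. Qed.

Lemma smooth_on_clin_comp E F G (U : set E) (f : E -> F) (L : clin F G) :
  open U -> smooth_on U f -> smooth_on U (fun x => L (f x)).
Proof. by move=> oU sf n; exact: Cn_on_clin_comp. Qed.

Lemma smooth_on_apply E F G (U : set E) (f : E -> clin F G) (g : E -> F) :
  open U -> smooth_on U f -> smooth_on U g -> smooth_on U (fun x => f x (g x)).
Proof. by move=> oU sf sg; exact: (smooth_on_bilin (clin_id (clin F G))). Qed.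

Lemma smooth_on_clin_compose E F G H (U : set E) (f : E -> clin G H)
    (g : E -> clin F G) : open U -> smooth_on U f -> smooth_on U g ->
  smooth_on U (fun x => clin_comp (f x) (g x)).
Proof. by move=> oU sf sg; exact: (smooth_on_bilin (clin_compose F G H)). Qed.

End SmoothCalculus.

(** * Coordinates and injections of finite powers *)

Section FfunLinear.
Variables (R : realType) (I : finType) (E : normedModType R).

Fact ffproj_linear (i : I) : linear (fun v : {ffun I -> E} => v i).
Proof. by move=> a u v; rewrite !ffunE. Qed.

Fact ffproj_bound (i : I) (v : {ffun I -> E}) : `|v i| <= 1 * `|v|.
Proof. by rewrite mul1r; exact: (le_bigmax _ (fun i => `|v i|)). Qed.

Definition ffproj (i : I) : clin {ffun I -> E} E :=
  mk_clin (ffproj_linear i) (ffproj_bound i).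

Definition ffsingle (i : I) (y : E) : {ffun I -> E} :=
  [ffun j => if j == i then y else 0].

Fact ffsingle_linear i : linear (ffsingle i).
Proof.
move=> a u v; apply/ffunP => j; rewrite !ffunE.
by case: ifPn => // _; rewrite scaler0 addr0.
Qed.

Fact ffsingle_bound i y : `|ffsingle i y| <= 1 * `|y|.
Proof.
rewrite mul1r; apply: bigmax_le => // j _; rewrite ffunE.
by case: ifPn => // _; rewrite normr0.
Qed.

Definition ffinj (i : I) : clin E {ffun I -> E} :=
  mk_clin (ffsingle_linear i) (ffsingle_bound i).

Lemma ffinjE i y j : ffinj i y j = if j == i then y else 0.
Proof. by rewrite /= ffunE. Qed.

(** Reduces smoothness of maps into a finite power to that of sums. *)
Lemma ffun_decomp (v : {ffun I -> E}) : v = \sum_i ffinj i (v i).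
Proof.
apply/ffunP => j; rewrite sum_ffunE (bigD1 j)//= ffinjE eqxx big1 ?addr0// => i ij.
by rewrite ffinjE eq_sym (negbTE ij).
Qed.

End FfunLinear.

(** * Derivatives of curves *)

Section Curves.
Variable R : realType.
Implicit Types E F G : normedModType R.

Lemma derive1_is_diff E (c : R -> E) (t : R) (L : clin R^o E) :
  is_diff (t : R^o) c L -> derive1 c t = L 1.
Proof.
move=> dc; have df : differentiable (c : R^o -> E) t by exact: ex_diff.
by rewrite derive1E' // [X in X 1]diff_val.
Qed.

Lemma eq_derive1 E (J : set R) (f g : R -> E) t :
  open J -> {in J, f =1 g} -> J t -> derive1 f t = derive1 g t.
Proof.
move=> oJ fg Jt; rewrite !derive1E; apply: near_eq_derive.
have : nbhs t J by exact: open_nbhs_nbhs.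
by apply: filterS => s Js; rewrite fg ?inE.
Qed.

Lemma eq_derive1n E (J : set R) (f g : R -> E) n :
  open J -> {in J, f =1 g} -> {in J, derive1n n f =1 derive1n n g}.
Proof.
move=> oJ fg; elim: n => // n IH t; rewrite inE => Jt.
by rewrite !derive1nS; exact: (eq_derive1 oJ).
Qed.

Lemma derive1_smooth E (J : set R) (c : R -> E) t :
  @smooth_on R R^o E J c -> J t -> derive1 c t = (fderiv c : R^o -> _) t 1.
Proof. by move=> sc Jt; exact: derive1_is_diff (smooth_on_is_diff sc Jt). Qed.

Lemma smooth_on_derive1 E (J : set R) (c : R -> E) : open J ->
  @smooth_on R R^o E J c -> @smooth_on R R^o E J (derive1 c).
Proof.
move=> oJ sc.
apply: (@eq_smooth_on _ _ _ _ (fun t : R^o => fderiv c t (1 : R^o))) => //.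
  by move=> t; rewrite inE => Jt; rewrite (derive1_smooth sc).
apply: smooth_on_apply => //; first exact: smooth_on_fderiv.
exact: smooth_on_cst.
Qed.

Lemma smooth_on_derive1n E (J : set R) (c : R -> E) n : open J ->
  @smooth_on R R^o E J c -> @smooth_on R R^o E J (derive1n n c).
Proof.
by move=> oJ sc; elim: n => // n IH; rewrite derive1nS; exact: smooth_on_derive1.
Qed.

Lemma derive1_chain E F (J : set R) (U : set E) (c : R -> E) (f : E -> F) t :
  @smooth_on R R^o E J c -> smooth_on U f -> J t -> U (c t) ->
  derive1 (f \o c) t = fderiv f (c t) (derive1 c t).
Proof.
move=> sc sf Jt Ut.
rewrite (derive1_smooth sc Jt).
rewrite (derive1_is_diff (is_diff_clin_comp
  (smooth_on_is_diff sc Jt) (smooth_on_is_diff sf Ut))).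
by rewrite clin_compE.
Qed.

Lemma derive1_clin E F (J : set R) (c : R -> E) (L : clin E F) t :
  @smooth_on R R^o E J c -> J t -> derive1 (fun s => L (c s)) t = L (derive1 c t).
Proof.
move=> sc Jt; rewrite (derive1_smooth sc Jt).
by rewrite (derive1_is_diff (is_diff_clin_comp
  (smooth_on_is_diff sc Jt) (is_diff_clin L (c t)))).
Qed.

Lemma derive1_apply E F (J : set R) (A : R -> clin E F) (V : R -> E) t :
  @smooth_on R R^o _ J A -> @smooth_on R R^o _ J V -> J t ->
  derive1 (fun s => A s (V s)) t = derive1 A t (V t) + A t (derive1 V t).
Proof.
move=> sA sV Jt; rewrite (derive1_smooth sA Jt) (derive1_smooth sV Jt).
by rewrite (derive1_is_diff (is_diff_bilin (clin_id (clin E F))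
  (smooth_on_is_diff sA Jt) (smooth_on_is_diff sV Jt))).
Qed.

Lemma derive1_sum E (J : set R) n (f : 'I_n -> R -> E) t :
  (forall i, @smooth_on R R^o E J (f i)) -> J t ->
  derive1 (fun s => \sum_(i < n) f i s) t = \sum_(i < n) derive1 (f i) t.
Proof.
move=> sf Jt.
have d i : derivable (f i) t 1.
  apply: (@diff_derivable _ R^o).
  by have [] := smooth_on_is_diff (sf i) Jt.
under eq_bigr do rewrite derive1E.
rewrite derive1E -derive_sum//.
by congr ('D_1 _ t); apply/funext => s; rewrite fct_sumE.
Qed.

End Curves.

(** * Covariant derivatives along a curve *)

Section CovariantDerivative.
Variables (R : realType) (E : normedModType R).
Implicit Types (Gam : E -> clin E (clin E E)) (c V : R -> E) (J : set R).

(** The covariant derivative of V along c in a chart where the connection has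
components Gam. *)
Definition covd Gam c V (t : R) : E :=
  derive1 V t + Gam (c t) (derive1 c t) (V t).

Lemma smooth_on_covd J (U : set E) Gam c V : open J ->
  @smooth_on R R^o E J c -> (forall t, J t -> U (c t)) -> smooth_on U Gam ->
  @smooth_on R R^o E J V -> @smooth_on R R^o E J (covd Gam c V).
Proof.
move=> oJ sc cU sG sV; apply: smooth_onD => //; first exact: smooth_on_derive1.
do 2 apply: smooth_on_apply => //; last exact: smooth_on_derive1.
exact: (smooth_on_comp oJ cU sc sG).
Qed.

(** The n-th covariant derivative of the velocity of c. *)
Definition acceleration Gam c n : R -> E := iter n (covd Gam c) (derive1 c).

Lemma accelerationS Gam c n :
  acceleration Gam c n.+1 = covd Gam c (acceleration Gam c n).
Proof. by []. Qed.

Lemma smooth_on_acceleration J (U : set E) Gam c n : open J ->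
  @smooth_on R R^o E J c -> (forall t, J t -> U (c t)) -> smooth_on U Gam ->
  @smooth_on R R^o E J (acceleration Gam c n).
Proof.
move=> oJ sc cU sG; elim: n => [|n IH]; first exact: smooth_on_derive1.
exact: smooth_on_covd cU sG IH.
Qed.

(** By the Christoffel law, d psi intertwines the two covariant derivatives: the second derivative of psi that appears when
d psi(c) V is differentiated is cancelled by the one in the law. Only c2 = psi o c1
on J is assumed, as charts composed with curves agree only where all are defined. *)
Lemma acceleration_transition J (U : set E) Gam1 Gam2 (psi : E -> E) c1 c2 n :
  open J -> @smooth_on R R^o E J c1 -> (forall t, J t -> U (c1 t)) ->
  smooth_on U Gam1 -> smooth_on U psi ->
  (forall x, U x -> forall xi y, fderiv psi x (Gam1 x xi y) =
      fderiv (fderiv psi) x xi y +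
      Gam2 (psi x) (fderiv psi x xi) (fderiv psi x y)) ->
  {in J, c2 =1 psi \o c1} ->
  {in J, forall t, acceleration Gam2 c2 n t =
                   fderiv psi (c1 t) (acceleration Gam1 c1 n t)}.
Proof.
move=> oJ sc cU sG sp Hp c2E.
have c2d t : J t -> derive1 c2 t = fderiv psi (c1 t) (derive1 c1 t).
  by move=> Jt; rewrite (eq_derive1 oJ c2E Jt) (derive1_chain sc sp Jt)//; exact: cU.
have sdp : @smooth_on R R^o _ J (fun t => fderiv psi (c1 t)).
  by apply: (smooth_on_comp oJ cU sc); exact: smooth_on_fderiv.
elim: n => [|n IH] t; rewrite inE => Jt; first exact: c2d.
rewrite !accelerationS /covd (eq_derive1 oJ IH Jt).
have sA := smooth_on_acceleration n oJ sc cU sG.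
rewrite (derive1_apply sdp sA Jt) linearD/= Hp; last exact: cU.
rewrite (IH t) ?inE// c2d// c2E ?inE//=.
have -> : derive1 (fun s => fderiv psi (c1 s)) t =
    fderiv (fderiv psi) (c1 t) (derive1 c1 t).
  by apply: (derive1_chain sc _ Jt (cU _ Jt)); exact: smooth_on_fderiv.
by rewrite [X in X + _ = _]addrC -addrA.
Qed.

End CovariantDerivative.

(** * The operators M as coefficients of iterated covariant derivatives *)

Section MopSmooth.
Variables (R : realType) (E : normedModType R) (Gam : E -> clin E (clin E E)).
Implicit Types (u : nat -> E) (y : E).

(** The defining recursion, also valid for j = 0 because M_0 = id is constant. *)
Lemma MopS j u y : Mop Gam j.+1 u y =
  j.+1%:R^-1 *: (\sum_(i < j.+1)
      'D_(i.+1%:R *: u i.+1)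
        (fun v : E => Mop Gam j [eta u with nat_of_ord i |-> v] y) (u i)
    + Gam (u 0%N) (u 1%N) (Mop Gam j u y)).
Proof.
case: j => [|j]; last by rewrite [LHS]/= big_add1 big_mkord.
by rewrite /= big_ord1 derive_cst add0r invr1 scale1r.
Qed.

Lemma eq_Mop j u u' y : (forall i, (i <= j)%N -> u i = u' i) ->
  Mop Gam j u y = Mop Gam j u' y.
Proof.
elim: j u u' y => // j IH u u' y uu; rewrite !MopS uu// uu// (IH u u')//; last first.
  by move=> i ij; rewrite uu// leqW.
congr (_ *: (_ + _)); apply: eq_bigr => i _.
rewrite (uu i.+1)// (uu i); last by rewrite ltnW.
have -> // : (fun v => Mop Gam j [eta u with nat_of_ord i |-> v] y) =
    (fun v => Mop Gam j [eta u' with nat_of_ord i |-> v] y).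
apply/funext => v; apply: IH => l lj /=.
by case: ifP => // _; rewrite uu// leqW.
Qed.

Variables (U : set E) (oU : open U) (sGam : smooth_on U Gam).

(** The variables u_0, ..., u_m as one point of a normed space, in which joint
smoothness makes sense. *)
Definition initial_vars m u : {ffun 'I_m.+1 -> E} := [ffun i : 'I_m.+1 => u i].

(** The points whose first variable, the base point, lies in the domain U of the chart. *)
Definition cylinder m : set {ffun 'I_m.+1 -> E} := [set v | U (v ord0)].

Lemma open_cylinder m : open (@cylinder m).
Proof.
rewrite /cylinder -[X in open X]/((ffproj E ord0) @^-1` U).
by apply: open_comp => // v _; exact: clin_continuous.
Qed.

(** If M_j is represented by a smooth map P of the variables (u_0, ..., u_m)
jointly, then the partial derivatives in the recursive definition of M_(j+1) are
values of the total derivative of P: changing only the variable u_i moves along an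
affine line in the i-th factor. *)
Lemma derive_partial m j (P : {ffun 'I_m.+1 -> E} -> clin E E) u y w
    (i : 'I_m.+1) :
  smooth_on (@cylinder m) P -> U (u 0%N) ->
  (forall u', U (u' 0%N) -> forall y', Mop Gam j u' y' = P (initial_vars m u') y') ->
  'D_w (fun v : E => Mop Gam j [eta u with nat_of_ord i |-> v] y) (u i) =
    fderiv P (initial_vars m u) (ffinj E i w) y.
Proof.
move=> sP Uu PE.
pose aff (v : E) := initial_vars m u + ffinj E i (v - u i).
have aff_diff : is_diff (u i) aff (ffinj E i).
  apply/is_diffP => e e0; near=> v.
  rewrite /aff subrr linear0 addr0 [initial_vars m u + _]addrC addrK subrr normr0.
  by rewrite mulr_ge0// ltW.
have affu : aff (u i) = initial_vars m u by rewrite /aff subrr linear0 addr0.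
have cyl_u : cylinder (initial_vars m u) by rewrite /cylinder/= ffunE.
have dP : is_diff (aff (u i)) P (fderiv P (initial_vars m u)).
  by rewrite affu; exact: smooth_on_is_diff sP cyl_u.
have dcomp := is_diff_clin_comp (is_diff_clin_comp aff_diff dP)
  (is_diff_clin (clin_flip (clin_id (clin E E)) y) _).
(* Only a change of the base point u_0 could leave the domain, and U is open. *)
have Ui : \forall v \near u i, nat_of_ord i = 0%N -> U v.
  have [i0|/eqP i0] := eqVneq (nat_of_ord i) 0%N; last by near=> v.
  by rewrite i0; apply: filterS (open_nbhs_nbhs (conj oU Uu)).
rewrite (@near_eq_derive _ _ _ _ (fun v => P (aff v) y)).
  have dcomp' : is_diff (u i) (fun v => P (aff v) y) _ := dcomp.
  by rewrite deriveE; [rewrite [X in X w]diff_val|case: dcomp'].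
near=> v.
have -> : aff v = initial_vars m [eta u with nat_of_ord i |-> v].
  apply/ffunP => l; rewrite /aff ffunE ffinjE !ffunE/= -val_eqE/=.
  by case: ifPn => [/eqP ->|_]; rewrite ?addr0// addrCA subrr addr0.
apply: PE => /=; case: ifPn => // /eqP/esym.
by near: v.
Unshelve. all: by end_near. Qed.

(** Smoothness in all variables jointly, with values in L(E, E). The number m + 1 of
variables is fixed in advance and only bounds j, so that all M_j with j <= m live
on the same space and the recursion can be carried out there. *)
Lemma Mop_smooth m j : (j <= m)%N -> exists P : {ffun 'I_m.+1 -> E} -> clin E E,
  smooth_on (@cylinder m) P /\
  forall u, U (u 0%N) -> forall y, Mop Gam j u y = P (initial_vars m u) y.
Proof.
elim: j => [_|j IH jm].
  exists (fun=> clin_id E); split => //.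
  by apply: smooth_on_cst; exact: open_cylinder.
have [P [sP PE]] := IH (ltnW jm).
have oO := @open_cylinder m.
pose shift (i : 'I_j.+1) : clin {ffun 'I_m.+1 -> E} {ffun 'I_m.+1 -> E} :=
  clin_comp (ffinj E (inord i)) (i.+1%:R *: ffproj E (inord i.+1)).
(* The recursion, with total derivatives of P in place of partial ones. *)
exists (fun v => j.+1%:R^-1 *: (\sum_(i < j.+1) fderiv P v (shift i v) +
  clin_comp (Gam (ffproj E ord0 v) (ffproj E (inord 1) v)) (P v))); split.
  have sc : forall f : {ffun 'I_m.+1 -> E} -> clin E E, smooth_on (@cylinder m) f ->
      smooth_on (@cylinder m) (fun v => j.+1%:R^-1 *: f v).
    by move=> f; exact: (smooth_on_clin_comp (j.+1%:R^-1 *: clin_id (clin E E)) oO).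
  apply: sc; apply: smooth_onD => //.
    apply: smooth_on_sum => // i _; apply: smooth_on_apply => //.
      exact: smooth_on_fderiv.
    exact: smooth_on_clin.
  apply: smooth_on_clin_compose => //; apply: smooth_on_apply => //.
    apply: (@smooth_on_comp _ _ _ _ _ U _ Gam) => //.
    exact: smooth_on_clin.
  exact: smooth_on_clin.
move=> u Uu y; rewrite MopS clin_scaleE clin_addE clin_sumE.
congr (_ *: (_ + _)).
  apply: eq_bigr => i _; rewrite clin_compE clin_scaleE.
  have im : (i < m.+1)%N by rewrite (leq_trans (ltn_ord i))// ltnW.
  have Si : (i.+1 < m.+1)%N by rewrite ltnS (leq_trans (ltn_ord i)).
  have := derive_partial y (i.+1%:R *: u i.+1) (inord i) sP Uu PE.
  rewrite inordK// => ->; congr (fderiv P _ (ffinj E _ (_ *: _)) _).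
  by rewrite /= ffunE inordK.
rewrite clin_compE PE//=; congr (Gam _ _ _); rewrite ffunE//.
by rewrite inordK// ltnS (leq_trans _ jm).
Qed.

(** [taylor_at c 0] is [taylor c]; the base point has to move in order to differentiate
in time. *)
Definition taylor_at (c : R -> E) (t : R) (j : nat) : E :=
  (j`!)%:R^-1 *: derive1n j c t.

Lemma derive1_taylor_at J (c : R -> E) t j : open J ->
  @smooth_on R R^o E J c -> J t ->
  derive1 (fun s => taylor_at c s j) t = j.+1%:R *: taylor_at c t j.+1.
Proof.
move=> oJ sc Jt; have sn := smooth_on_derive1n j oJ sc.
rewrite (derive1_clin ((j`!)%:R^-1 *: clin_id E) sn Jt).
rewrite clin_scaleE /taylor_at scalerA factS natrM invfM mulrA divff ?mul1r//.
Qed.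

Lemma smooth_on_taylor_at J (c : R -> E) j : open J ->
  @smooth_on R R^o E J c -> @smooth_on R R^o E J (fun s => taylor_at c s j).
Proof.
move=> oJ sc.
apply: (smooth_on_clin_comp ((j`!)%:R^-1 *: clin_id E) oJ).
exact: smooth_on_derive1n.
Qed.

(** Along the curve u_l = c^(l) / l! the velocity of u_i is (i+1) u_(i+1), which is
exactly the direction of the (i+1)-st partial derivative in the recursion; hence the
sum of the partial derivatives is the derivative of M_j in time. *)
Lemma Mop_curve J (c : R -> E) j : open J -> @smooth_on R R^o E J c ->
  (forall t, J t -> U (c t)) -> exists N : R -> clin E E,
  [/\ @smooth_on R R^o _ J N,
      forall t, J t -> forall y, N t y = Mop Gam j (taylor_at c t) y &
      forall t, J t -> forall y, j.+1%:R *: Mop Gam j.+1 (taylor_at c t) y =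
        derive1 N t y + Gam (c t) (derive1 c t) (N t y)].
Proof.
move=> oJ sc cU; have [P [sP PE]] := @Mop_smooth j j (leqnn j).
pose ut t := initial_vars j (taylor_at c t).
have T0 t : taylor_at c t 0 = c t by rewrite /taylor_at fact0 invr1 scale1r.
have T1 t : taylor_at c t 1 = derive1 c t by rewrite /taylor_at invr1 scale1r.
have utE : ut = fun t => \sum_(i < j.+1) ffinj E i (taylor_at c t i).
  apply/funext => t; rewrite [LHS]ffun_decomp.
  by apply: eq_bigr => i _; rewrite ffunE.
have sinj (i : 'I_j.+1) : @smooth_on R R^o _ J (fun t => ffinj E i (taylor_at c t i) : {ffun 'I_j.+1 -> E}).
  by apply: smooth_on_clin_comp => //; exact: smooth_on_taylor_at.
have sut : @smooth_on R R^o _ J ut.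
  by rewrite utE; apply: smooth_on_sum.
have utO t : J t -> cylinder (ut t) by move=> Jt; rewrite /cylinder/= ffunE T0; exact: cU.
exists (P \o ut); split.
- exact: (smooth_on_comp oJ utO sut sP).
- by move=> t Jt y; rewrite PE// T0; exact: cU.
- move=> t Jt y; have UT : U (taylor_at c t 0) by rewrite T0; exact: cU.
  rewrite MopS scalerA divff ?pnatr_eq0// scale1r T0 T1 PE//; congr (_ + _).
  rewrite (derive1_chain sut sP Jt (utO _ Jt)).
  rewrite {2}utE (derive1_sum sinj Jt) linear_sum clin_sumE.
  apply: eq_bigr => i _.
  rewrite (derive_partial _ _ _ sP UT PE).
  rewrite (derive1_clin _ (smooth_on_taylor_at i oJ sc) Jt).
  by rewrite (derive1_taylor_at i oJ sc Jt).
Qed.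

Lemma pascal_sum (V : lmodType R) (f : nat -> V) n :
  \sum_(j < n.+1) f j.+1 *+ 'C(n, j) + \sum_(j < n.+1) f j *+ 'C(n, j) =
  \sum_(j < n.+2) f j *+ 'C(n.+1, j).
Proof.
rewrite [RHS]big_ord_recl/= bin0.
under [in RHS]eq_bigr do rewrite /bump leq0n add1n binS mulrnDr.
rewrite big_split/= [X in _ + (X + _)]big_ord_recr/= bin_small// mulr0n addr0.
by rewrite [X in _ + X]big_ord_recl bin0 addrCA [X in _ = _ + X]addrC addrA addrC.
Qed.

(** With K_j = j! M_j the recursion reads K_(j+1) = K_j' + Gam K_j; differentiating
K_j c^(n-j+1) covariantly gives K_(j+1) c^(n-j+1) + K_j c^(n-j+2), and Pascal's rule
collects the terms. *)
Lemma acceleration_Mop J (c : R -> E) n : open J -> @smooth_on R R^o E J c ->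
  (forall t, J t -> U (c t)) -> forall t, J t ->
  acceleration Gam c n t = \sum_(j < n.+1)
    ((j`!)%:R *: Mop Gam j (taylor_at c t) (derive1n (n - j).+1 c t)) *+ 'C(n, j).
Proof.
move=> oJ sc cU.
have [N NP] := choice (fun j => Mop_curve j oJ sc cU).
(* Rescaled so that the recursion has no denominators. *)
pose K j (t : R) : clin E E := (j`!)%:R *: N j t.
have sK j : @smooth_on R R^o _ J (K j).
  apply: (smooth_on_clin_comp ((j`!)%:R *: clin_id (clin E E)) oJ).
  by case: (NP j).
have KE j t y : J t -> K j t y = (j`!)%:R *: Mop Gam j (taylor_at c t) y.
  by move=> Jt; rewrite /K clin_scaleE; case: (NP j) => _ ->.
have KS j t y : J t ->
    K j.+1 t y = derive1 (K j) t y + Gam (c t) (derive1 c t) (K j t y).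
  move=> Jt; rewrite KE// factS mulnC natrM -scalerA.
  have [sN _ ->//] := NP j; rewrite scalerDr; congr (_ + _).
    rewrite /K (derive1_clin ((j`!)%:R *: clin_id (clin E E)) sN Jt).
    by rewrite clin_scaleE.
  by rewrite clin_scaleE linearZ.
clearbody K.
suff H : forall t, J t -> acceleration Gam c n t = \sum_(j < n.+1)
    K j t (derive1n (n - j).+1 c t) *+ 'C(n, j).
  by move=> t Jt; rewrite H//; apply: eq_bigr => j _; rewrite KE.
elim: n => [|n IH] t Jt.
  by rewrite big_ord1 bin0 KE// fact0 scale1r.
have smul (f : R -> E) (k : nat) : @smooth_on R R^o E J f ->
    @smooth_on R R^o E J (fun s => f s *+ k).
  move=> sf; have := smooth_on_clin_comp (k%:R *: clin_id E) oJ sf.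
  by apply: eq_smooth_on => // s _; rewrite clin_scaleE scaler_nat.
have sterm j : @smooth_on R R^o E J (fun s => K j s (derive1n (n - j).+1 c s)).
  by apply: smooth_on_apply => //; exact: smooth_on_derive1n.
have IHJ : {in J, acceleration Gam c n =1 fun s => \sum_(j < n.+1)
    K j s (derive1n (n - j).+1 c s) *+ 'C(n, j)}.
  by move=> s; rewrite inE; exact: IH.
rewrite accelerationS /covd (eq_derive1 oJ IHJ Jt) IH//.
rewrite (derive1_sum (fun i => smul _ _ (sterm i)) Jt).
rewrite linear_sum -big_split/=.
rewrite -(pascal_sum (fun j => K j t (derive1n (n.+1 - j).+1 c t))) -big_split/=.
apply: eq_bigr => j _.
have -> : derive1 (fun s => K j s (derive1n (n - j).+1 c s) *+ 'C(n, j)) t =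
    derive1 (fun s => K j s (derive1n (n - j).+1 c s)) t *+ 'C(n, j).
  have := derive1_clin ('C(n, j)%:R *: clin_id E) (sterm j) Jt.
  rewrite [RHS]clin_scaleE [RHS]scaler_nat => <-.
  by congr (derive1 _ t); apply/funext => s; rewrite clin_scaleE scaler_nat.
rewrite (derive1_apply (sK j) (smooth_on_derive1n _ oJ sc) Jt).
rewrite raddfMn -!mulrnDl; congr (_ *+ _).
rewrite /= subSS KS// subSn -1?ltnS//.
by rewrite addrAC.
Qed.

(** The factors binomial(n, j) j! and 1 / (n - j)! combine to n!, so the two sums agree
term by term. *)
Lemma zcoord_acceleration J (c : R -> E) n : open J -> @smooth_on R R^o E J c ->
  (forall t, J t -> U (c t)) -> J 0 ->
  zcoord Gam c n.+1 = (n.+1`!)%:R^-1 *: acceleration Gam c n 0.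
Proof.
move=> oJ sc cU J0; rewrite (acceleration_Mop n oJ sc cU J0) /zcoord.
rewrite factS natrM invfM -scalerA; congr (_ *: _).
rewrite -(big_mkord xpredT (fun j => ((j`!)%:R *:
  Mop Gam j (taylor_at c 0) (derive1n (n - j).+1 c 0)) *+ 'C(n, j))) big_ltn//.
rewrite bin0 fact0 scale1r mulr1n subn0 scalerDr; congr (_ + _).
rewrite !big_add1 !succnK !big_mkord scaler_sumr; apply: eq_bigr => i _.
rewrite -scaler_nat !scalerA.
rewrite subSS subn1 -subnS -[(n - i)%N]subnSK//; congr (_ *: _).
have nE : (n`!)%:R = ('C(n, i.+1))%:R * (i.+1`!)%:R * ((n - i.+1)`!)%:R :> R.
  by rewrite -!natrM -mulnA bin_fact.
have f0 k : (k`!)%:R != 0 :> R by rewrite pnatr_eq0 -lt0n fact_gt0.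
rewrite nE.
have C0 : ('C(n, i.+1))%:R != 0 :> R by rewrite pnatr_eq0 -lt0n bin_gt0.
move: (f0 i.+1) (f0 (n - i.+1)%N) C0.
move: (i.+1`!)%:R ((n - i.+1)`!)%:R ('C(n, i.+1))%:R => a b d a0 b0 d0.
by field; rewrite a0 b0 d0.
Qed.

End MopSmooth.

(** * Triangularity of the fibre coordinates *)

Section ZCoordinates.
Variables (R : realType) (E : normedModType R) (Gam : E -> clin E (clin E E)).
Implicit Types d : nat -> E.

(** [zcoord] as a function of the sequence of derivatives at 0. *)
Definition zseq d (i : nat) : E :=
  i%:R^-1 *: ((i.-1`!)%:R^-1 *: d i +
    \sum_(1 <= j < i) ((i - j - 1)`!)%:R^-1 *:
      Mop Gam j (fun l => (l`!)%:R^-1 *: d l) (d (i - j)%N)).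

Lemma zcoordE (c : R -> E) i : zcoord Gam c i = zseq (fun j => derive1n j c 0) i.
Proof. by []. Qed.

Lemma eq_zseq_sum d d' i : (forall j, (j < i)%N -> d j = d' j) ->
  \sum_(1 <= j < i) ((i - j - 1)`!)%:R^-1 *:
      Mop Gam j (fun l => (l`!)%:R^-1 *: d l) (d (i - j)%N) =
  \sum_(1 <= j < i) ((i - j - 1)`!)%:R^-1 *:
      Mop Gam j (fun l => (l`!)%:R^-1 *: d' l) (d' (i - j)%N).
Proof.
move=> dd; apply: eq_big_nat => j /andP[j1 ji].
rewrite dd; last by rewrite ltn_subrL j1 (leq_trans j1)// ltnW.
congr (_ *: _); apply: eq_Mop => l lj.
by rewrite dd// (leq_ltn_trans lj).
Qed.

Lemma eq_zseq d d' i : (forall j, (j <= i)%N -> d j = d' j) ->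
  zseq d i = zseq d' i.
Proof.
move=> dd; rewrite /zseq dd// (@eq_zseq_sum d d')// => j ji.
by rewrite dd// ltnW.
Qed.

(** [zseq d i] is a nonzero multiple of [d i] plus terms in [d j], j < i. *)
Lemma zseq_inj d d' k : d 0%N = d' 0%N ->
  (forall i, (1 <= i <= k)%N -> zseq d i = zseq d' i) ->
  forall j, (j <= k)%N -> d j = d' j.
Proof.
move=> d0 zz; elim/ltn_ind => -[//|j] IH jk.
have := zz j.+1; rewrite jk => /(_ isT); rewrite /zseq.
rewrite (@eq_zseq_sum d d'); last first.
  by move=> l lj; rewrite IH// (leq_trans _ jk)// ltnW.
move=> /(scalerI (invr_neq0 _)); rewrite pnatr_eq0 => /(_ isT)/addIr.
by move=> /(scalerI (invr_neq0 _)); apply; rewrite pnatr_eq0 -lt0n fact_gt0.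
Qed.

(** By the same triangularity, the entries of [d] can be solved for one after the other. *)
Lemma zseq_surj x (z : nat -> E) k : exists d, d 0%N = x /\
  forall i, (1 <= i <= k)%N -> zseq d i = z i.
Proof.
elim: k => [|k [d [d0 dz]]].
  by exists (fun=> x); split => // -[|i] /andP[].
pose r := \sum_(1 <= j < k.+1) ((k.+1 - j - 1)`!)%:R^-1 *:
      Mop Gam j (fun l => (l`!)%:R^-1 *: d l) (d (k.+1 - j)%N).
(* The value at k + 1 is the solution of zseq e k.+1 = z k.+1. *)
pose e : nat -> E := [eta d with k.+1 |-> (k`!)%:R *: (k.+1%:R *: z k.+1 - r)].
have ed j : (j <= k)%N -> e j = d j.
  by move=> jk; rewrite /e/= ltn_eqF.
exists e; split; first by rewrite ed.
move=> i /andP[i1]; rewrite leq_eqVlt => /predU1P[->|]; last first.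
  rewrite ltnS => ik; rewrite -dz ?i1//; apply: eq_zseq => j ji.
  by rewrite ed// (leq_trans ji).
rewrite /zseq (@eq_zseq_sum e d); last by move=> j jk; rewrite ed.
rewrite -/r {1}/e/= eqxx scalerA mulVf ?scale1r; last first.
  by rewrite pnatr_eq0 -lt0n fact_gt0.
by rewrite subrK scalerA mulVf ?scale1r// pnatr_eq0.
Qed.

End ZCoordinates.

(** * Curves with prescribed derivatives *)

Section PolynomialCurves.
Variables (R : realType).
Implicit Type E : normedModType R.

Fact scalel_clin_linear E (v : E) : linear (fun h : R^o => h *: v).
Proof. by move=> a h h'; rewrite scalerDl scalerA. Qed.

Fact scalel_clin_bound E (v : E) (h : R^o) : `|h *: v| <= `|v| * `|h|.
Proof. by rewrite normrZ mulrC. Qed.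

Definition scalel_clin E (v : E) : clin R^o E :=
  mk_clin (scalel_clin_linear v) (scalel_clin_bound v).

Lemma smooth_on_exprn n : @smooth_on R R^o R^o setT (fun t => t ^+ n).
Proof.
elim: n => [|n IH].
  by apply: (eq_smooth_on openT _ (@smooth_on_cst _ R^o R^o setT 1 openT)).
have id_smooth : @smooth_on R R^o R^o setT (fun t => t).
  exact: (smooth_on_clin (clin_id R^o) openT).
apply: (eq_smooth_on openT _
  (smooth_on_bilin (scalel_clin (clin_id R^o)) openT id_smooth IH)).
by move=> t _; rewrite exprS.
Qed.

(** The polynomial curve with derivatives d_0, ..., d_k at 0. *)
Definition taylor_poly E k (d : nat -> E) (t : R) : E :=
  \sum_(j < k.+1) scalel_clin ((j`!)%:R^-1 *: d j) (t ^+ j).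

Lemma smooth_on_taylor_poly E k (d : nat -> E) :
  @smooth_on R R^o E setT (taylor_poly k d).
Proof.
apply: smooth_on_sum; first exact: openT.
move=> j _; apply: smooth_on_clin_comp; first exact: openT.
exact: smooth_on_exprn.
Qed.

Lemma taylor_poly0 E k (d : nat -> E) : taylor_poly k d 0 = d 0%N.
Proof.
rewrite /taylor_poly big_ord_recl big1 ?addr0 /=.
  by rewrite expr0 fact0 invr1 !scale1r.
by move=> i _; rewrite expr0n scale0r.
Qed.

Lemma derive1_taylor_poly E k (d : nat -> E) :
  derive1 (taylor_poly k.+1 d) = taylor_poly k (d \o S).
Proof.
apply/funext => t; rewrite /taylor_poly (derive1_sum (J := setT))//; last first.
  by move=> j; apply: smooth_on_clin_comp; [exact: openT|exact: smooth_on_exprn].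
under eq_bigr => j _.
  rewrite (derive1_clin _ (smooth_on_exprn j) I).
over.
rewrite big_ord_recl [X in X + _](_ : _ = 0) ?add0r; last first.
  have -> : derive1 (fun t : R => t ^+ (ord0 : 'I_k.+2)) t = 0.
    exact: derive1_cst.
  by rewrite linear0.
apply: eq_bigr => j _; rewrite exp_derive1 lift0 /=.
rewrite !scalerA; congr (_ *: _).
rewrite factS natrM invfM -[_ *: _]/(_ * _) mulrACA divff ?pnatr_eq0//.
by rewrite mul1r.
Qed.

Lemma derive1n_taylor_poly E k (d : nat -> E) j :
  (j <= k)%N -> derive1n j (taylor_poly k d) 0 = d j.
Proof.
elim: k j d => [|k IH] [|j] d//= jk; rewrite ?taylor_poly0//.
rewrite -[LHS]/(derive1n j.+1 (taylor_poly k.+1 d) 0).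
by rewrite derive1Sn derive1_taylor_poly IH.
Qed.

End PolynomialCurves.

(** * Curves in a manifold, read in charts *)

Lemma open_norm_lt (R : realType) (r : R) : open [set t : R | `|t| < r].
Proof.
have -> : [set t : R | `|t| < r] = `](- r), r[%classic.
  by apply/seteqP; split => t /=; rewrite in_itv/= ltr_norml.
exact: interval_open.
Qed.

Section Charts.
Variables (R : realType) (E : normedModType R) (M : topologicalType).
Variable A : atlas E M.
Implicit Types (a b : idx A) (x : M).

(** A point y near chart a x is chart a z for some z in [dom a]; continuity of the
inverse chart puts z in [dom b] as well. *)
Lemma open_overlap a b : open (chart a @` (dom a `&` dom b)).
Proof.
rewrite openE => _ [x [ax bx] <-]; rewrite /interior.
have ca : nbhs (chart a x) (chart a @` dom a).
  by apply: open_nbhs_nbhs; split; [exact: chart_open|exists x].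
have cb : nbhs (chart a x) (chartV a @^-1` dom b).
  apply: (chartV_continuous ax); rewrite chartK//.
  by apply: open_nbhs_nbhs; split; [exact: dom_open|].
apply: filterS2 ca cb => _ [z az <-] /=; rewrite chartK// => bz.
by exists z.
Qed.

Lemma transition_chart a b x : dom a x -> transition a b (chart a x) = chart b x.
Proof. by move=> ax; rewrite /transition/= chartK. Qed.

(** The parameters at which c can be read in the chart a. *)
Definition curve_dom x (c : curve A x) a : set R :=
  [set t | `|t| < Defs.rad c /\ dom a (c t)].

Lemma open_curve_dom x (c : curve A x) a : open (curve_dom c a).
Proof.
rewrite openE => t [tc at_]; rewrite /interior.
have tn : nbhs t [set s : R | `|s| < Defs.rad c].
  apply: open_nbhs_nbhs; split => //.
  exact: open_norm_lt.
have cn : nbhs t (c @^-1` dom a).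
  apply: (cfun_continuous tc).
  by apply: open_nbhs_nbhs; split; [exact: dom_open|].
by apply: filterS2 tn cn => s ? ?; split.
Qed.

Lemma curve_dom0 x (c : curve A x) a : dom a x -> curve_dom c a 0.
Proof. by move=> ax; split; rewrite ?cfun0// normr0 rad_gt0. Qed.

(** The polynomial curve, read in the chart, stays in the chart domain for small
parameters, which gives the radius; the smoothness in another chart is that of a
transition map composed with a polynomial. *)
Lemma curve_exists a x k (d : nat -> E) : dom a x -> d 0%N = chart a x ->
  exists c : curve A x,
    forall j, (j <= k)%N -> derive1n j (chart a \o c) 0 = d j.
Proof.
move=> ax d0; pose p := taylor_poly k d.
have sp : @smooth_on R R^o E setT p by exact: smooth_on_taylor_poly.
have pc t : {for t, continuous p}.
  by have := sp 0%N t I.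
have p0 : p 0 = chart a x by rewrite /p taylor_poly0.
have oU : open (chart a @` dom a) by exact: chart_open.
have : nbhs (0 : R) (p @^-1` (chart a @` dom a)).
  by apply: (pc 0); rewrite p0; apply: open_nbhs_nbhs; split.
move=> /nbhs_norm0P[r /= r0 rU].
have pU t : `|t| < r -> (chart a @` dom a) (p t) by move=> tr; exact: rU.
pose c := chartV a \o p.
have c0 : c 0 = x by rewrite /c/= p0 chartK.
have cc t : `|t| < r -> {for t, continuous c}.
  move=> /pU [y ay yE]; apply: continuous_comp; first exact: pc.
  by rewrite -yE; exact: chartV_continuous.
have oJ b : open [set t : R^o | `|t| < r /\ dom b (c t)].
  rewrite openE => t [tr bt]; rewrite /interior.
  have tn : nbhs t [set s : R | `|s| < r].
    apply: open_nbhs_nbhs; split => //.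
    exact: open_norm_lt.
  have cn : nbhs t (c @^-1` dom b).
    apply: (cc _ tr).
    by apply: open_nbhs_nbhs; split; [exact: dom_open|].
  by apply: filterS2 tn cn => s ? ?; split.
have cs b : @smooth_on R R^o E [set t | `|t| < r /\ dom b (c t)] (chart b \o c).
  apply: (@smooth_on_comp _ R^o _ _ _ (chart a @` (dom a `&` dom b)) p
    (chart b \o chartV a)) => //.
  - move=> t [/pU [y ay yE]]; rewrite /c/= -yE chartK// => byy.
    by exists y.
  - exact: smooth_on_subset sp.
  - exact: transition_smooth.
exists (Curve r0 c0 cc cs) => j jk.
have oJa := oJ a.
have J0 : [set t : R^o | `|t| < r /\ dom a (c t)] 0.
  by split; rewrite ?normr0// c0.
rewrite -(@derive1n_taylor_poly _ _ k d j jk).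
apply: (eq_derive1n _ oJa); last by rewrite inE.
move=> t; rewrite inE => -[/pU [y ay yE] _] /=.
by rewrite /c/= -/p -yE chartK.
Qed.

End Charts.

(** * Jets of curves and the trivializations *)

Section Jets.
Variables (R : realType) (E : normedModType R) (M : topologicalType).
Variables (A : atlas E M) (nabla : linear_connection A).
Implicit Types (a b : idx A) (x : M).

Lemma acceleration_chart x (c : curve A x) a b n : dom a x -> dom b x ->
  acceleration (nabla b) (chart b \o c) n 0 =
  fderiv (transition a b) (chart a x) (acceleration (nabla a) (chart a \o c) n 0).
Proof.
move=> ax bx.
pose J : set R^o := curve_dom c a `&` curve_dom c b.
pose U := chart a @` (dom a `&` dom b).
have oJ : open J by apply: openI; exact: open_curve_dom.
have J0 : J 0 by split; exact: curve_dom0.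
have JU t : J t -> U ((chart a \o c) t) by move=> [[_ ?] [_ ?]]; exists (c t).
have sc : @smooth_on R R^o E J (chart a \o c).
  by apply: smooth_on_subset (@cfun_smooth _ _ _ _ _ c a) => t [].
have sG : smooth_on U (nabla a).
  apply: smooth_on_subset (christoffel_smooth nabla a) => _ [y [ay _] <-].
  by exists y.
have cE : {in J, chart b \o c =1 transition a b \o (chart a \o c)}.
  by move=> t; rewrite inE => -[[_ ?] _] /=; rewrite transition_chart.
rewrite (acceleration_transition n oJ sc JU sG (@transition_smooth _ _ _ A a b)
  (@christoffel_transition _ _ _ _ nabla a b) cE) ?inE//=.
by rewrite cfun0.
Qed.

Lemma zcoord_chart_acceleration x (c : curve A x) a n : dom a x ->
  zcoord (nabla a) (chart a \o c) n.+1 =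
  (n.+1`!)%:R^-1 *: acceleration (nabla a) (chart a \o c) n 0.
Proof.
move=> ax; apply: (zcoord_acceleration (@chart_open _ _ _ A a)
  (christoffel_smooth nabla a) n (@open_curve_dom _ _ _ _ _ c a)
  (@cfun_smooth _ _ _ _ _ c a)); last exact: curve_dom0.
by move=> t [_ act]; exists (c t).
Qed.

Lemma zcoord_chart x (c : curve A x) a b n : dom a x -> dom b x ->
  zcoord (nabla b) (chart b \o c) n.+1 =
  fderiv (transition a b) (chart a x) (zcoord (nabla a) (chart a \o c) n.+1).
Proof.
move=> ax bx; rewrite !zcoord_chart_acceleration// (acceleration_chart c n ax bx).
by rewrite linearZ.
Qed.

Lemma zcoord_derive1n x (c1 c2 : curve A x) a k :
  (forall i, (i < k)%N -> zcoord (nabla a) (chart a \o c1) i.+1 =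
                          zcoord (nabla a) (chart a \o c2) i.+1) <->
  (forall j, (j <= k)%N ->
     derive1n j (chart a \o c1) 0 = derive1n j (chart a \o c2) 0).
Proof.
split=> [zz|dd].
  apply: (zseq_inj (Gam := nabla a)) => /=; first by rewrite !cfun0.
  by move=> [//|i] /= ik; rewrite -!zcoordE; exact: zz.
move=> i ik; rewrite !zcoordE; apply: eq_zseq => j ji.
by apply: dd; rewrite (leq_trans ji).
Qed.

(** The definition of [jet_eq] refers to some chart around x. Any chart gives the same
relation: equality of derivatives is equality of the z^i by triangularity, and the
z^i in two charts are related by a linear map. *)
Lemma jet_eqP x (c1 c2 : curve A x) a k : dom a x ->
  jet_eq k c1 c2 <-> forall i, (i < k)%N ->
    zcoord (nabla a) (chart a \o c1) i.+1 = zcoord (nabla a) (chart a \o c2) i.+1.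
Proof.
move=> ax; split=> [[b bx dd] i ik|/zcoord_derive1n dd]; last first.
  by exists a => // j /andP[_]; exact: dd.
rewrite !(zcoord_chart _ _ bx ax); congr (fderiv _ _ _).
move: i ik; apply/zcoord_derive1n => -[_|j jk]; last exact: dd.
by rewrite /= !cfun0.
Qed.

Lemma jet_eq_refl k x (c : curve A x) : jet_eq k c c.
Proof. by have [a ax] := dom_cover A x; exists a. Qed.

Lemma jet_eq_sym k x (c1 c2 : curve A x) : jet_eq k c1 c2 -> jet_eq k c2 c1.
Proof. by move=> [a ax dd]; exists a => // j jk; rewrite dd. Qed.

Lemma jet_eq_trans k x (c1 c2 c3 : curve A x) :
  jet_eq k c1 c2 -> jet_eq k c2 c3 -> jet_eq k c1 c3.
Proof.
have [a ax] := dom_cover A x.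
move=> /(jet_eqP _ _ _ ax) h1 /(jet_eqP _ _ _ ax) h2.
by apply/(jet_eqP _ _ _ ax) => i ik; rewrite h1// h2.
Qed.

Definition jet_of k x (c : curve A x) : jet A k x :=
  exist _ [set c' | jet_eq k c c'] (ex_intro _ c erefl).

Lemma jet_reprP k x (T : jet A k x) :
  proj1_sig T = [set c | jet_eq k (jet_repr T) c].
Proof. exact: projT2 (cid (proj2_sig T)). Qed.

Lemma jet_of_repr k x (c : curve A x) : jet_eq k c (jet_repr (jet_of k c)).
Proof.
suff : [set c' | jet_eq k c c'] (jet_repr (jet_of k c)) by [].
rewrite -[X in X _]/(proj1_sig (jet_of k c)) [X in X _]jet_reprP.
exact: jet_eq_refl.
Qed.

(** Uses that [jet_eq] is symmetric and transitive, so that equivalent representatives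
have the same class. *)
Lemma jet_ext k x (T1 T2 : jet A k x) :
  jet_eq k (jet_repr T1) (jet_repr T2) -> T1 = T2.
Proof.
move=> T12; apply: eq_sig_hprop => [? ? ?|]; first exact: Prop_irrelevance.
rewrite !jet_reprP; apply/seteqP; split=> c /= Tc.
  exact: jet_eq_trans (jet_eq_sym T12) Tc.
exact: jet_eq_trans T12 Tc.
Qed.

(** Injectivity is [jet_eqP]; for surjectivity, solve the triangular system for the
derivatives and take a curve that has them. *)
Lemma triv_bij k a x : dom a x ->
  bijective (fun T => triv (higher_tangent_bundle nabla k) a (x := x) T).
Proof.
move=> ax; pose f T := triv (higher_tangent_bundle nabla k) a (x := x) T.
have fE (T : jet A k x) (i : 'I_k) :
    f T i = zcoord (nabla a) (chart a \o jet_repr T) i.+1.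
  by rewrite /f/= ffunE.
have finj : injective f.
  move=> T1 T2 T12; apply: jet_ext; apply/(jet_eqP _ _ _ ax) => i ik.
  by have /ffunP/(_ (Ordinal ik)) := T12; rewrite !fE.
have fsurj (v : {ffun 'I_k -> E}) : exists T, f T = v.
  (* zseq counts the coordinates from 1, the index set of v from 0. *)
  pose z i : E := if insub i.-1 is Some j then v j else 0.
  have [d [d0 dz]] := zseq_surj (nabla a) (chart a x) z k.
  have [c cd] := curve_exists k ax d0.
  exists (jet_of k c); apply/ffunP => i; rewrite fE.
  have /(jet_eqP _ _ _ ax) <-// := jet_of_repr k c.
  rewrite zcoordE (eq_zseq _ (d' := d)); last first.
    by move=> j ji; rewrite cd// (leq_trans ji).
  by rewrite dz ?ltn_ord// /z/= insubT//= => ik; congr (v _); exact: val_inj.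
have [g gK] := choice fsurj.
by exists g => // T; apply: finj; rewrite gK.
Qed.

End Jets.

(** * Diagonal maps and forms on finite powers *)

Section BlockDiagonal.
Variables (R : realType) (E : normedModType R) (I : finType).

Definition blockdiag (L : clin E E) : clin {ffun I -> E} {ffun I -> E} :=
  \sum_i clin_comp (ffinj E i) (clin_comp L (ffproj E i)).

Lemma blockdiagE L v : blockdiag L v = [ffun i => L (v i)].
Proof.
rewrite [RHS]ffun_decomp clin_sumE; apply: eq_bigr => i _.
by rewrite clin_compE ffunE.
Qed.

Lemma smooth_on_blockdiag (U : set E) (f : E -> clin E E) : open U ->
  smooth_on U f -> smooth_on U (fun x => blockdiag (f x)).
Proof.
move=> oU sf; apply: smooth_on_sum => // i _.
apply: smooth_on_clin_compose => //; first exact: smooth_on_cst.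
by apply: smooth_on_clin_compose => //; exact: smooth_on_cst.
Qed.

Definition blockform (b : clin E (clin E R^o)) :
    clin {ffun I -> E} (clin {ffun I -> E} R^o) :=
  \sum_i clin_comp (clin_pre R^o (ffproj E i)) (clin_comp b (ffproj E i)).

Lemma blockformE b u v : blockform b u v = \sum_i b (u i) (v i).
Proof. by rewrite /blockform !clin_sumE. Qed.

Lemma smooth_on_blockform (U : set E) (f : E -> clin E (clin E R^o)) : open U ->
  smooth_on U f -> smooth_on U (fun x => blockform (f x)).
Proof.
move=> oU sf; apply: smooth_on_sum => // i _.
apply: smooth_on_clin_compose => //; first exact: smooth_on_cst.
by apply: smooth_on_clin_compose => //; exact: smooth_on_cst.
Qed.

(** The inverse is assembled from the inverse S of b: a form phi on the power is sent
to the family of the S(phi restricted to the i-th factor). *)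
Lemma metric_form_block (b : clin E (clin E R^o)) :
  metric_form b -> metric_form (blockform b).
Proof.
move=> [bsym bpos [S [bS Sb]]].
have b0 v : 0 <= (b v v : R).
  have [->|v0] := eqVneq v 0; first by rewrite linear0.
  exact/ltW/bpos.
split=> [u v|u u0|].
- by rewrite !blockformE; apply: eq_bigr => i _; exact: bsym.
- have [i ui] : exists i, u i != 0.
    apply/existsP; apply: contraNT u0; rewrite negb_exists => /forallP u0.
    by apply/eqP/ffunP => i; rewrite ffunE; apply/eqP; rewrite -[_ == _]negbK.
  rewrite blockformE (bigD1 i)//= ltr_wpDr ?bpos//.
  by apply: sumr_ge0 => j _.
- pose T : clin (clin {ffun I -> E} R^o) {ffun I -> E} :=
    \sum_i clin_comp (ffinj E i) (clin_comp S (clin_pre R^o (ffinj E i))).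
  have TE phi i : T phi i = S (clin_comp phi (ffinj E i)).
    rewrite clin_sumE sum_ffunE (bigD1 i)//= ffinjE eqxx big1 ?addr0//.
    by move=> j ji; rewrite ffinjE eq_sym (negbTE ji).
  exists T; split=> [u|phi].
    apply/ffunP => i; rewrite TE -[RHS]bS; congr (S _); apply: clin_eqP => y.
    rewrite clin_compE blockformE (bigD1 i)//= ffinjE eqxx big1 ?addr0//.
    by move=> j ji; rewrite ffinjE (negbTE ji) linear0.
  apply: clin_eqP => v; rewrite blockformE [in RHS](ffun_decomp v) linear_sum.
  by apply: eq_bigr => i _; rewrite TE Sb.
Qed.

End BlockDiagonal.

(** * The lifted metric *)

Section LiftedMetric.
Variables (R : realType) (E : normedModType R) (M : topologicalType).
Variables (A : atlas E M) (nabla : linear_connection A) (k : nat).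

(** All k fibre coordinates are transformed by the same differential. *)
Lemma triv_transition (a b : idx A) x (T : jet A k x) : dom a x -> dom b x ->
  triv (higher_tangent_bundle nabla k) b T =
  blockdiag _ (fderiv (transition a b) (chart a x))
    (triv (higher_tangent_bundle nabla k) a T).
Proof.
move=> ax bx; rewrite blockdiagE; apply/ffunP => i.
by rewrite !ffunE (zcoord_chart nabla _ _ ax bx).
Qed.

Lemma is_vector_bundle_higher : is_vector_bundle (higher_tangent_bundle nabla k).
Proof.
split=> [a x ax|a b]; first exact: triv_bij.
exists (fun x => blockdiag _ (fderiv (transition a b) x)); split.
  apply: smooth_on_blockdiag; first exact: open_overlap.
  by apply: smooth_on_fderiv; exact: transition_smooth.
by move=> x ax bx T; exact: triv_transition.
Qed.

(** The case n = 0 of the transformation of covariant derivatives: there the velocity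
itself is transformed. *)
Lemma tangent_transition (a b : idx A) x (T : jet A 1 x) : dom a x -> dom b x ->
  triv (tangent_bundle A) b T =
  fderiv (transition a b) (chart a x) (triv (tangent_bundle A) a T).
Proof.
by move=> ax bx; exact: (acceleration_chart nabla (jet_repr T) 0 ax bx).
Qed.

Variables (g : forall x, fibre (tangent_bundle A) x ->
  fibre (tangent_bundle A) x -> R) (gloc : idx A -> E -> clin E (clin E R^o)).
Hypotheses (bundle_TM : is_vector_bundle (tangent_bundle A))
  (hgloc : forall a, local_rep g a (gloc a)).

Lemma tangent_triv_surj a x (y : E) : dom a x ->
  exists T : jet A 1 x, triv (tangent_bundle A) a T = y.
Proof.
move=> ax; have [h _ hK] := bundle_TM.1 a x ax.
by exists (h y); exact: hK.
Qed.

(** A local representative is determined on the chart domain, because every vector of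
E is the coordinate of a tangent vector. So the smoothness and
positivity of any representative hold for all of them. *)
Lemma local_rep_unique (b : E -> clin E (clin E R^o)) a x :
  local_rep g a b -> dom a x -> b (chart a x) = gloc a (chart a x).
Proof.
move=> hb ax; apply: clin_eqP => u; apply: clin_eqP => v.
have [Tu <-] := tangent_triv_surj u ax; have [Tv <-] := tangent_triv_surj v ax.
by rewrite -hb// -hgloc.
Qed.

(** Both sides are the value of g on the tangent vectors with coordinates u and v. *)
Lemma gloc_transition a b x u v : dom a x -> dom b x ->
  gloc b (chart b x) (fderiv (transition a b) (chart a x) u)
    (fderiv (transition a b) (chart a x) v) = gloc a (chart a x) u v.
Proof.
move=> ax bx.
have [Tu <-] := tangent_triv_surj u ax; have [Tv <-] := tangent_triv_surj v ax.
by rewrite -!tangent_transition// -!hgloc.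
Qed.

(** The substitution of the transformed coordinates leaves each summand unchanged, by
[gloc_transition]. *)
Lemma lifted_metric_chart a b x (T1 T2 : jet A k x) : dom a x -> dom b x ->
  lifted_metric gloc nabla b T1 T2 = lifted_metric gloc nabla a T1 T2.
Proof.
move=> ax bx; apply: eq_bigr => i _.
by rewrite !(triv_transition _ ax bx) !blockdiagE !ffunE gloc_transition.
Qed.

End LiftedMetric.

Theorem mainTheorem7 (R : realType) (E : completeNormedModType R)
    (hE : hilbert_norm E \/ self_dual E)
    (M : topologicalType) (A : atlas E M)
    (g : forall x : M, fibre (tangent_bundle A) x ->
                       fibre (tangent_bundle A) x -> R)
    (hg : riemannian_metric g)
    (gloc : idx A -> E -> clin E (clin E R^o))
    (hgloc : forall a : idx A, local_rep g a (gloc a))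
    (nabla : linear_connection A)
    (k : nat) (hk : (1 <= k)%N) :
  exists G : forall x : M, fibre (higher_tangent_bundle nabla k) x ->
                           fibre (higher_tangent_bundle nabla k) x -> R,
    (forall (a : idx A) (x : M), dom a x -> forall T1 T2 : jet A k x,
       G x T1 T2 = lifted_metric gloc nabla a T1 T2) /\
    riemannian_metric G.
Proof.
have [bundle_TM gE] := hg.
pose chart_at x := projT1 (cid (dom_cover A x)).
have chart_atP x : dom (chart_at x) x by exact: (projT2 (cid (dom_cover A x))).
pose G (x : M) (T1 T2 : jet A k x) :=
  lifted_metric gloc nabla (chart_at x) T1 T2.
have GE (a : idx A) (x : M) : dom a x -> forall T1 T2 : jet A k x,
    G x T1 T2 = lifted_metric gloc nabla a T1 T2.
  by move=> ax T1 T2; exact: (lifted_metric_chart nabla bundle_TM hgloc).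
exists G; split; first exact: GE.
split; first exact: is_vector_bundle_higher.
move=> a; have [b [gb sb mb]] := gE a.
exists (fun x => blockform _ (b x)); split.
- move=> x ax T1 T2; rewrite (GE a)// blockformE; apply: eq_bigr => i _.
  by rewrite (local_rep_unique bundle_TM hgloc gb ax).
- by apply: smooth_on_blockform => //; exact: chart_open.
- by move=> x ax; exact/metric_form_block/mb.
Qed.
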